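(* Let $\mathcal{A}$ be a finite set, let $P_A\in\Delta(\mathcal{A})$, and let $(G_a)_{a \in \mathcal{A}}$ be a family of perfect probabilistic graphs. Then $$\overline{H}\left(\bigwedge_{a \in \mathcal{A}} G_a \right) = \sum_{a \in \mathcal{A}} \overline{H}(G_a) = \sum_{a \in \mathcal{A}} H_\kappa(G_a),$$ $$\overline{H}\left(\bigsqcup_{a \in \mathcal{A}}^{P_A} G_a \right) = \sum_{a \in \mathcal{A}} P_A(a) \overline{H}(G_a) = \sum_{a \in \mathcal{A}} P_A(a) H_\kappa(G_a).$$
   Context: $\Delta(\mathcal{X})$ denotes the set of probability distributions on a finite set $\mathcal{X}$. A probabilistic graph is a tuple $G=(\mathcal{V},\mathcal{E},P_V)$ where $(\mathcal{V},\mathcal{E})$ is a finite simple undirected graph and $P_V\in\Delta(\mathcal{V})$. It is called perfect if the graph $(\mathcal{V},\mathcal{E})$ is perfect, i.e. for every $\mathcal{S}\subset\mathcal{V}$ the induced subgraph on $\mathcal{S}$ has chromatic number equal to its clique number. AND product: $G_1\wedge G_2$ has vertex set $\mathcal{V}_1\times\mathcal{V}_2$, distribution $P_{V_1}P_{V_2}$ (product distribution), and two distinct vertices $(v_1,v_2),(v_1',v_2')$ are adjacent iff ($v_1=v_1'$ or $v_1v_1'\in\mathcal{E}_1$) and ($v_2=v_2'$ or $v_2v_2'\in\mathcal{E}_2$). $G^{\wedge n}$ is the $n$-fold AND product $G\wedge\dots\wedge G$. Disjoint union: for $G_a=(\mathcal{V}_a,\mathcal{E}_a,P_{V_a})$,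 $\bigsqcup_{a\in\mathcal{A}}^{P_A}G_a$ has vertex set the disjoint union of the $\mathcal{V}_a$; two vertices are adjacent iff they lie in the same $\mathcal{V}_a$ and are adjacent in $G_a$; its distribution is $\sum_{a}P_A(a)P_{V_a}$. A coloring of $G$ is a map $c$ on $\mathcal{V}$ such that adjacent vertices receive different values. The chromatic entropy is $H_\chi(G)=\inf\{H(c(V)) : c \text{ a coloring of } G\}$, where $V\sim P_V$ and $H$ is Shannon entropy (logarithms in base 2). The complementary graph entropy is $\overline{H}(G)=\lim_{n\to\infty}\frac1n H_\chi(G^{\wedge n})$ (the limit exists). Körner graph entropy: let $\Gamma(G)$ be the collection of independent sets of vertices of $G$. Then $H_\kappa(G)=\min I(W;V)$, where $V\sim P_V$, $I$ is mutual information, and the minimum is over all conditional distributions $P_{W|V}$ of a random variable $W$ with values in $\Gamma(G)$ such that $V\in W$ with probability one. *)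

(* Defs.v *)
From mathcomp Require Import all_boot all_order all_algebra.
From mathcomp Require Import all_classical all_reals all_analysis.
Set Implicit Arguments.
Unset Strict Implicit.
Unset Printing Implicit Defensive.
Import Order.TTheory GRing.Theory Num.Theory.
Import numFieldNormedType.Exports.
Local Open Scope classical_set_scope.
Local Open Scope ring_scope.

Record sgraph := SGraph {
  vertex :> finType;
  adj : rel vertex;
  adj_sym : symmetric adj;
  adj_irr : irreflexive adj }.

Definition is_coloring (G : sgraph) (C : eqType) (c : G -> C) : bool :=
  [forall x, forall y, adj x y ==> (c x != c y)].

Definition colorable (G : sgraph) (k : nat) : bool :=
  [exists c : {ffun G -> 'I_k}, is_coloring c].

Lemma ex_colorable (G : sgraph) : exists k, colorable G k.
Proof.
exists #|G|; apply/existsP; exists [ffun x => enum_rank x].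
apply/'forall_forallP => x y; apply/implyP => xy.
rewrite !ffunE (inj_eq enum_rank_inj).
by apply/eqP => exy; rewrite exy adj_irr in xy.
Qed.

Definition chromatic_number (G : sgraph) : nat := ex_minn (ex_colorable G).

Definition is_clique (G : sgraph) (K : {set G}) : bool :=
  [forall x in K, forall y in K, (x != y) ==> adj x y].

Definition clique_number (G : sgraph) : nat :=
  \max_(K : {set G} | is_clique K) #|K|.

Definition independent (G : sgraph) (S : {set G}) : bool :=
  [forall x in S, forall y in S, ~~ adj x y].

Section Induced.
Variables (G : sgraph) (S : {set G}).

Definition induced_adj : rel {x : G | x \in S} := fun x y => adj (val x) (val y).

Lemma induced_adj_sym : symmetric induced_adj.
Proof. by move=> x y; rewrite /induced_adj adj_sym. Qed.

Lemma induced_adj_irr : irreflexive induced_adj.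
Proof. by move=> x; rewrite /induced_adj adj_irr. Qed.

Definition induced : sgraph := SGraph induced_adj_sym induced_adj_irr.
End Induced.

Definition perfect (G : sgraph) : Prop :=
  forall S : {set G}, chromatic_number (induced S) = clique_number (induced S).

Record fdist (R : realType) (T : finType) := FDist {
  fdist_fun :> T -> R;
  fdist_ge0 : forall x, 0 <= fdist_fun x;
  fdist_sum1 : \sum_x fdist_fun x = 1 }.

Record pgraph (R : realType) := PGraph {
  pg_graph :> sgraph;
  pdist : fdist R pg_graph }.

(* The vertices of the AND product of a family are the choice functions
   picking a vertex in each factor. *)
Section AndProduct.
Variables (R : realType) (A : finType) (G : A -> pgraph R).

Let V : finType := {dffun forall a : A, G a}.

Definition and_adj : rel V := fun v w =>
  (v != w) && [forall a, (v a == w a) || adj (v a) (w a)].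

Lemma and_adj_sym : symmetric and_adj.
Proof.
move=> v w; rewrite /and_adj eq_sym; congr andb.
by apply: eq_forallb => a; rewrite eq_sym adj_sym.
Qed.

Lemma and_adj_irr : irreflexive and_adj.
Proof. by move=> v; rewrite /and_adj eqxx. Qed.

Definition and_prob (v : V) : R := \prod_a pdist (G a) (v a).

Lemma and_prob_ge0 v : 0 <= and_prob v.
Proof. by apply: prodr_ge0 => a _; apply: fdist_ge0. Qed.

Lemma and_prob_sum1 : \sum_v and_prob v = 1.
Proof.
rewrite (reindex (@dffun_of_fprod A (fun a => G a))); last first.
  exact/onW_bij/dffun_of_fprod_bij.
pose P_ a := [ffun x : G a => pdist (G a) x].
transitivity (\sum_(t : fprod (fun a => G a)) \prod_(a in A) P_ a (t a)).
  by apply: eq_bigr => t _; apply: eq_bigr => a _; rewrite !ffunE.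
rewrite big_fprod -(bigA_distr_big_dep _ (fun a x => untag 0 (P_ a) x)).
rewrite big1 // => a _.
rewrite -[RHS](fdist_sum1 (pdist (G a))).
rewrite [RHS](eq_bigr (P_ a)) => [|x _]; last by rewrite ffunE.
exact: (esym (big_tag (fun a => P_ a) a)).
Qed.

Definition and_prod : pgraph R :=
  @PGraph R (SGraph and_adj_sym and_adj_irr) (FDist and_prob_ge0 and_prob_sum1).
End AndProduct.

Definition and_power (R : realType) (G : pgraph R) (n : nat) : pgraph R :=
  and_prod (fun _ : 'I_n => G).

Section DisjointUnion.
Variables (R : realType) (A : finType) (PA : fdist R A) (G : A -> pgraph R).

Let V : finType := {a : A & G a}.

(* When the tags agree, [tagged_as v w] is the component of [w] seen as a
   vertex of the graph of [v]. *)
Definition union_adj : rel V := fun v w =>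
  (tag v == tag w) && adj (tagged v) (tagged_as v w).

Lemma union_adj_sym : symmetric union_adj.
Proof.
move=> [a x] [b y]; rewrite /union_adj /=.
have [eab|] := eqVneq a b; last by [].
by case: b / eab y => y; rewrite !tagged_asE /= adj_sym.
Qed.

Lemma union_adj_irr : irreflexive union_adj.
Proof. by move=> [a x]; rewrite /union_adj tagged_asE adj_irr andbF. Qed.

Definition union_prob (v : V) : R := PA (tag v) * pdist (G (tag v)) (tagged v).

Lemma union_prob_ge0 v : 0 <= union_prob v.
Proof. by apply: mulr_ge0; apply: fdist_ge0. Qed.

Lemma union_prob_sum1 : \sum_v union_prob v = 1.
Proof.
rewrite -(sig_big_dep xpredT (fun _ _ => true)
            (fun a x => PA a * pdist (G a) x)) /=.
rewrite -[RHS](fdist_sum1 PA); apply: eq_bigr => a _.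
by rewrite -mulr_sumr fdist_sum1 mulr1.
Qed.

Definition disjoint_union : pgraph R :=
  @PGraph R (SGraph union_adj_sym union_adj_irr)
    (FDist union_prob_ge0 union_prob_sum1).
End DisjointUnion.

Section Entropies.
Variable R : realType.

Definition log2 (x : R) : R := ln x / ln 2.

(* No case distinction is needed for the convention 0 log 0 = 0. *)
Definition entropy (T : finType) (p : T -> R) : R :=
  - \sum_x p x * log2 (p x).

Definition pushforward (T C : finType) (c : T -> C) (p : T -> R) : C -> R :=
  fun z => \sum_(x | c x == z) p x.

(* Mutual information of the two components of a pair with joint law [p]. *)
Definition mutual_info (T U : finType) (p : T * U -> R) : R :=
  \sum_z p z * log2 (p z / (pushforward fst p z.1 * pushforward snd p z.2)).

Definition chromatic_entropy (G : pgraph R) : R :=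
  inf [set h | exists (C : finType) (c : G -> C),
         is_coloring c /\ h = entropy (pushforward c (pdist G))].

Definition compl_graph_entropy (G : pgraph R) : R :=
  limn (fun n : nat => chromatic_entropy (and_power G n) / n%:R).

Definition indep_sets (G : sgraph) : finType := {S : {set G} | independent S}.

Definition joint_law (G : pgraph R) (K : G -> fdist R (indep_sets G)) :
    indep_sets G * G -> R :=
  fun wv => pdist G wv.2 * K wv.2 wv.1.

(* The minimum is attained (continuity on a compact set), so it is the
   infimum. *)
Definition korner_entropy (G : pgraph R) : R :=
  inf [set h | exists K : G -> fdist R (indep_sets G),
         \sum_(wv : indep_sets G * G | wv.2 \in val wv.1) joint_law K wv = 1
         /\ h = mutual_info (joint_law K)].
End Entropies.

(* Main.v *)
(* For a fractional clique [a] (a mixture of clique indicators) and a fractional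
   independent set [b] (a mixture of independent set indicators), put
   [low a = sum P ln (a / P)] and [up b = - sum P ln b], in nats.
   - Every colouring has entropy at least [low a]: a colour class is independent,
     so [v |-> a v * P (class of v)] is a subprobability and Gibbs' inequality
     applies.
   - Some colouring has entropy at most [up b + ln (1 + ln #|G|)]: choose
     independent sets one after the other and colour a vertex by the number of the
     first set containing it; the sets can be chosen so that the mean logarithm
     of this number is at most [up b].
   Both quantities are additive under AND products and affine under disjoint unions,
   and [low a <= H_kappa <= up b].  Hence if the two families have a common limit
   value [x], then both the complementary graph entropy and the Körner entropy equal
   [x], and this property is inherited by AND products and disjoint unions.
   For a perfect graph it holds with [x = sup low]: at a near-maximizer [a] the
   first-order conditions say that [P / a] has weight at most about 1 on every
   clique, and then Lovász's replication argument writes it, up to a small error, as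
   a fractional independent set. *)
Require Import Defs.
From mathcomp Require Import all_boot all_order all_algebra ring lra.
From mathcomp Require Import all_classical all_reals all_analysis.
Set Implicit Arguments.
Unset Strict Implicit.
Unset Printing Implicit Defensive.
Import Order.TTheory GRing.Theory Num.Theory.
Import numFieldNormedType.Exports.
Local Open Scope ring_scope.

(** * Weighted colorings of perfect graphs *)

Section WeightedColoring.
Variable G : sgraph.
Implicit Types (S K X : {set G}) (w : G -> nat).

Lemma independent0 : independent (finset.set0 : {set G}).
Proof. by apply/forall_inP => x; rewrite inE. Qed.

Lemma is_clique1 (v : G) : is_clique [set v].
Proof.
apply/forall_inP => x /set1P ->; apply/forall_inP => y /set1P ->.
by rewrite eqxx.
Qed.

Lemma card_cliqueI S K : is_clique K -> independent S -> (#|S :&: K| <= 1)%N.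
Proof.
move=> /forall_inP cK /forall_inP iS; apply/card_le1P => x /setIP[xS xK] y.
rewrite !inE; have [->|yx] := eqVneq y x; first by rewrite xS xK.
apply/negP => /andP[yS yK].
have /forall_inP/(_ _ yK) := cK _ xK; rewrite eq_sym yx /= => xy.
by have /forall_inP/(_ _ yS) := iS _ xS; rewrite xy.
Qed.

Lemma sum_count_mem (s : seq {set G}) K :
  (\sum_(v in K) count (fun S : {set G} => v \in S) s = \sum_(S <- s) #|S :&: K|)%N.
Proof.
under eq_bigr do rewrite -sum1_count big_mkcond.
rewrite exchange_big; apply: eq_bigr => S _.
by rewrite -big_mkcondr sum1_card; apply: eq_card => v; rewrite !inE andbC.
Qed.

(** Cliques of the induced subgraph are cliques of [G], and each of their vertices has weight at
    least 1. This turns a bound on clique weights into a bound on the clique number of the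
    subgraph. *)
Lemma card_induced_clique S (K : {set Defs.induced S}) w :
  is_clique K -> (forall v, v \in S -> 0 < w v)%N ->
  exists2 K' : {set G}, is_clique K' & (#|K| <= \sum_(v in K') w v)%N.
Proof.
move=> /forall_inP cK w_gt0; exists [set val x | x in K].
  apply/forall_inP => _ /imsetP[x xK ->]; apply/forall_inP => _ /imsetP[y yK ->].
  apply/implyP => xy; have /forall_inP/(_ _ yK)/implyP := cK _ xK.
  by apply; apply: contraNneq xy => ->.
rewrite -(card_imset _ val_inj) -sum1_card leq_sum// => _ /imsetP[x _ ->].
exact: w_gt0 (valP x).
Qed.

(** Base case of replication: with weights 0 and 1, perfectness colours the subgraph induced on the
    support, and the colour classes form the cover. *)
Lemma support_coloring w m : perfect G -> (forall v, w v <= 1)%N ->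
  (forall K, is_clique K -> \sum_(v in K) w v <= m)%N ->
  exists s : seq {set G}, [/\ size s = m, all (fun S => independent S) s &
    forall v, count (fun S : {set G} => v \in S) s = w v].
Proof.
move=> pG w1 wm; pose S := [set v | (0 < w v)%N].
have km : (chromatic_number (Defs.induced S) <= m)%N.
  rewrite pG; apply/bigmax_leqP => K cK.
  have [|K' cK' le] := card_induced_clique (w := w) cK.
    by move=> v; rewrite inE.
  exact: leq_trans le (wm _ cK').
rewrite /chromatic_number in km; move: km.
case: ex_minnP => k /existsP[c /forallP cP] _ km.
pose cl (i : 'I_k) : {set G} := [set val x | x in [set x : Defs.induced S | c x == i]].
(* Empty sets pad the [k] colour classes to exactly [m] sets without changing any count. *)
exists ([seq cl i | i <- enum 'I_k] ++ nseq (m - k) finset.set0); split.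
- by rewrite size_cat size_map size_nseq size_enum_ord subnKC.
- rewrite all_cat; apply/andP; split.
    apply/allP => _ /mapP[i _ ->]; apply/forall_inP => _ /imsetP[x xi ->].
    apply/forall_inP => _ /imsetP[y yi ->]; apply/negP => xy.
    move: xi yi; rewrite !inE => /eqP xi /eqP yi.
    by have /forallP/(_ y) := cP x; rewrite xi yi eqxx implybF => /negP; apply.
  by apply/allP => X /nseqP[-> _]; exact: independent0.
- move=> v; rewrite count_cat count_nseq inE mul0n addn0 count_map.
  have [wv|] := posnP (w v).
    rewrite wv; apply/eqP; rewrite -leqn0 leqNgt -has_count; apply/hasPn => i _ /=.
    by apply/imsetP => -[x _ vx]; have := valP x; rewrite -vx inE wv.
  move=> wv; have vS : v \in S by rewrite inE.
  have -> : w v = 1%N by apply/eqP; rewrite eqn_leq w1.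
  rewrite (eq_count (a2 := pred1 (c (Sub v vS : Defs.induced S)))).
    by rewrite count_uniq_mem ?enum_uniq// mem_enum.
  move=> i /=; apply/imsetP/eqP => [[x xi vx]|->]; last first.
    by exists (Sub v vS); rewrite ?inE.
  move: xi; rewrite inE => /eqP <-; congr (c _); apply: val_inj.
  by rewrite /= -vx.
Qed.

(* Lovász's replication lemma: a vertex of weight at least 2 is lowered by one,
   an independent set [X] through it is taken from the resulting cover, and the
   weights are lowered along [X]; every clique loses one unit. *)
Lemma weighted_coloring w m : perfect G ->
  (forall K, is_clique K -> \sum_(v in K) w v <= m)%N ->
  exists s : seq {set G}, [/\ size s = m, all (fun S => independent S) s &
    forall v, count (fun S : {set G} => v \in S) s = w v].
Proof.
move=> pG; have [n] := ubnP (\sum_v w v); elim: n w m => // n IH w m.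
rewrite ltnS => wn wm.
have [/forallP w1|] := boolP [forall v, (w v <= 1)%N].
  exact: support_coloring.
rewrite negb_forall => /existsP[v]; rewrite -ltnNge => wv.
pose w' u := (w u - (u == v))%N.
have w'w u : (w' u <= w u)%N by exact: leq_subr.
have sum_lt (f : G -> nat) : (forall u, f u <= w u)%N -> (f v < w v)%N ->
    (\sum_u f u < n)%N.
  move=> fw fv; apply: leq_trans wn; rewrite (bigD1 v)//= [X in (_ < X)%N](bigD1 v)//=.
  by rewrite -addSn leq_add// leq_sum.
have [||s [sz sI sw]] := IH w' m.
- by apply: sum_lt => //; rewrite /w' eqxx subn1 ltn_predL (leq_trans _ wv).
- by move=> K /wm; apply: leq_trans; exact: leq_sum.
have [X Xs vX] : exists2 X, X \in s & v \in X.
  apply/hasP; rewrite has_count sw /w' eqxx subn1.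
  by case: (w v) wv => [|[]].
have Xw u : ((u \in X) <= w u)%N.
  apply: leq_trans (w'w u); rewrite -sw.
  case uX: (u \in X) => //; rewrite -has_count; by apply/hasP; exists X.
pose w'' u := (w u - (u \in X))%N.
have m_gt0 : (0 < m)%N.
  by rewrite -sz; case: (s) Xs.
have [||s'' [sz'' sI'' sw'']] := IH w'' m.-1.
- apply: sum_lt => [u|]; first exact: leq_subr.
  by rewrite /w'' vX subn1 ltn_predL (leq_trans _ wv).
- move=> K cK; rewrite -ltnS (prednK m_gt0).
  have [vK|vK] := boolP (v \in K).
    apply: leq_trans (wm K cK); rewrite (bigD1 v)//= [X in (_ < X)%N](bigD1 v)//=.
    rewrite -addSn leq_add//; first by rewrite /w'' vX subn1 ltn_predL (leq_trans _ wv).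
    by apply: leq_sum => u _; exact: leq_subr.
  (* Off [v] the weights [w] and [w'] agree, so the weight of [K] counts its incidences with the
     cover [s]. Without [X] there remain [m - 1] sets, each meeting [K] at most once. *)
  have eX : (\sum_(u in K) w'' u + #|X :&: K| = \sum_(S <- s) #|S :&: K|)%N.
    rewrite -sum_count_mem -sum1_card.
    rewrite [X in (_ + X)%N](eq_bigl (fun u => (u \in K) && (u \in X))); last first.
      by move=> u; rewrite inE andbC.
    rewrite big_mkcondr -big_split /=; apply: eq_bigr => u uK.
    rewrite sw /w' /w''.
    have /negPf -> : u != v by apply: contraNneq vK => <-.
    rewrite subn0; case uX: (u \in X); last by rewrite subn0 addn0.
    by rewrite subnK// (leq_trans _ (Xw u)) ?uX.
  move/eqP: eX; rewrite (big_rem X)//= addnC eqn_add2l => /eqP ->.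
  rewrite -[ltnRHS](prednK m_gt0) ltnS -sz -(size_rem Xs) -sum1_size.
  rewrite [leqLHS]big_seq [leqRHS]big_seq leq_sum// => S /mem_rem Ss.
  by apply: card_cliqueI => //; exact: (allP sI).
exists (X :: s''); split => /=.
- by rewrite sz'' prednK.
- by rewrite sI'' andbT (allP sI).
- by move=> u; rewrite sw'' /w'' subnKC.
Qed.

End WeightedColoring.

(** * Logarithms and Gibbs' inequality *)

Section Logarithm.
Variable R : realType.
Implicit Type T : finType.

Lemma ln_le_sub1 (x : R) : 0 < x -> ln x <= x - 1.
Proof. by move=> x0; rewrite -{1}(subrK 1 x) addrC le_ln1Dx// ltrBrDl subrr. Qed.

Lemma ln_ge_1BV (x : R) : 0 < x -> 1 - x^-1 <= ln x.
Proof.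
move=> x0; have := @ln_le_sub1 x^-1; rewrite invr_gt0 => /(_ x0).
by rewrite lnV ?posrE// => h; lra.
Qed.

Lemma ln2_gt0 : 0 < ln (2 : R).
Proof. by rewrite ln_gt0// ltr1n. Qed.

(** Minus the cross entropy, in nats; where [p] vanishes, the value of [b] is irrelevant. *)
Definition xent T (p b : T -> R) : R := \sum_x p x * ln (b x).

(** On the support of [p], [ln (s x / p x) <= s x / p x - 1]; weighting by [p x] and summing leaves
    the difference of the two masses. *)
Lemma gibbs T (p s : T -> R) : (forall x, 0 <= p x) -> (forall x, 0 <= s x) ->
  (forall x, 0 < p x -> 0 < s x) -> \sum_x s x <= \sum_x p x ->
  xent p s <= xent p p.
Proof.
move=> p0 s0 ps sp; rewrite -subr_le0 -sumrB.
apply: (@le_trans _ _ (\sum_x (s x - p x))); last by rewrite sumrB subr_le0.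
apply: ler_sum => x _; rewrite -mulrBr.
have [px|px] := boolP (0 < p x); last first.
  have -> : p x = 0 by apply/eqP; rewrite eq_le p0 andbT leNgt.
  by rewrite mul0r subr0.
rewrite -ln_div ?posrE ?ps//.
have := @ln_le_sub1 (s x / p x); rewrite divr_gt0 ?ps// => /(_ isT) h.
apply: (le_trans (ler_wpM2l (p0 x) h)).
by rewrite mulrBr mulr1 mulrCA divff ?gt_eqF// mulr1.
Qed.

Lemma xent_mulr T (p b c : T -> R) : (forall x, 0 <= p x) ->
  (forall x, 0 < p x -> 0 < b x) -> (forall x, 0 < p x -> 0 < c x) ->
  xent p (fun x => b x * c x) = xent p b + xent p c.
Proof.
move=> p0 pb pc; rewrite -big_split; apply: eq_bigr => x _ /=.
have [px|px] := boolP (0 < p x); last first.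
  have -> : p x = 0 by apply/eqP; rewrite eq_le p0 andbT leNgt.
  by rewrite !mul0r addr0.
by rewrite lnM ?posrE ?pb ?pc// mulrDr.
Qed.

Lemma xentV T (p b : T -> R) : (forall x, 0 <= p x) ->
  (forall x, 0 < p x -> 0 < b x) -> xent p (fun x => (b x)^-1) = - xent p b.
Proof.
move=> p0 pb; rewrite /xent -sumrN; apply: eq_bigr => x _ /=.
have [px|px] := boolP (0 < p x); last first.
  have -> : p x = 0 by apply/eqP; rewrite eq_le p0 andbT leNgt.
  by rewrite !mul0r oppr0.
by rewrite lnV ?posrE ?pb// mulrN.
Qed.

Lemma le_xent T (p b c : T -> R) : (forall x, 0 <= p x) ->
  (forall x, 0 < p x -> 0 < b x) -> (forall x, 0 < p x -> b x <= c x) ->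
  xent p b <= xent p c.
Proof.
move=> p0 pb bc; apply: ler_sum => x _.
have [px|px] := boolP (0 < p x); last first.
  have -> : p x = 0 by apply/eqP; rewrite eq_le p0 andbT leNgt.
  by rewrite !mul0r.
by rewrite ler_wpM2l// ler_ln ?posrE ?pb// ?(lt_le_trans (pb _ px)) ?bc.
Qed.

Lemma xent_cst T (p : fdist R T) (c : R) : xent p (fun=> c) = ln c.
Proof. by rewrite /xent -mulr_suml fdist_sum1 mul1r. Qed.

Lemma eq_xent T (p b c : T -> R) : (forall x, p x != 0 -> b x = c x) ->
  xent p b = xent p c.
Proof.
move=> bc; apply: eq_bigr => x _.
by have [->|/bc->] := eqVneq (p x) 0; rewrite ?mul0r.
Qed.

Lemma entropyE T (p : T -> R) : entropy p = - xent p p / ln 2.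
Proof.
rewrite /entropy /log2 mulNr mulr_suml; congr (- _).
by apply: eq_bigr => x _; rewrite mulrA.
Qed.

Lemma sum_pushforward T (C : finType) (c : T -> C) (p : T -> R) (f : C -> R) :
  \sum_z Defs.pushforward c p z * f z = \sum_x p x * f (c x).
Proof.
rewrite [RHS](partition_big c predT)//=; apply: eq_bigr => z _.
by rewrite mulr_suml; apply: eq_bigr => x /eqP ->.
Qed.

Lemma pushforward_ge0 T (C : finType) (c : T -> C) (p : fdist R T) z :
  0 <= Defs.pushforward c p z.
Proof. by apply: sumr_ge0 => x _; exact: fdist_ge0. Qed.

Lemma le_pushforward T (C : finType) (c : T -> C) (p : fdist R T) x :
  p x <= Defs.pushforward c p (c x).
Proof.
rewrite /Defs.pushforward (bigD1 x)//= lerDl; apply: sumr_ge0 => y _.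
exact: fdist_ge0.
Qed.

Lemma sum_pushforward1 T (C : finType) (c : T -> C) (p : T -> R) :
  \sum_z Defs.pushforward c p z = \sum_x p x.
Proof. by rewrite [RHS](partition_big c predT). Qed.

Lemma le_mean T (p : fdist R T) (f : T -> R) : exists x, f x <= \sum_y p y * f y.
Proof.
set m := \sum_y _; apply: contrapT => /forallNP h.
have mf x : m < f x by rewrite ltNge; exact/negP.
have : \sum_y p y * (f y - m) = 0.
  by under eq_bigr do rewrite mulrBr; rewrite sumrB -mulr_suml fdist_sum1 mul1r subrr.
move/eqP; rewrite psumr_eq0 => [/allP h0|y _]; last first.
  by rewrite mulr_ge0 ?fdist_ge0// subr_ge0 ltW.
have := fdist_sum1 p; rewrite big1 => [/eqP|y _]; first by rewrite eq_sym oner_eq0.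
have /eqP := h0 y (mem_index_enum _).
by move/eqP; rewrite mulf_eq0 subr_eq0 (gt_eqF (mf y)) orbF => /eqP.
Qed.

Lemma fdist_le1 T (p : fdist R T) (P : pred T) : \sum_(x | P x) p x <= 1.
Proof.
rewrite -(fdist_sum1 p) [leRHS](bigID P)/= lerDl.
by apply: sumr_ge0 => x _; exact: fdist_ge0.
Qed.

(** Each new term [1 / (n + 2)] is at most [ln ((n + 2) / (n + 1))], by [1 - 1 / x <= ln x]. The
    case of the empty sum relies on the default [ln 0 = 0]. *)
Lemma harmonic_le_ln n : \sum_(i < n) (i.+1%:R : R)^-1 <= 1 + ln n%:R.
Proof.
elim: n => [|n IH]; first by rewrite big_ord0 ln0 ?addr0 ?ler01.
rewrite big_ord_recr /=; case: n IH => [|n] IH.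
  by rewrite big_ord0 add0r invr1 ln1 addr0.
have h : 1 - (n.+2%:R / n.+1%:R : R)^-1 <= ln (n.+2%:R / n.+1%:R).
  by apply: ln_ge_1BV; rewrite divr_gt0.
rewrite ln_div ?posrE ?ltr0n// in h.
have e : (n.+2%:R : R)^-1 = 1 - (n.+2%:R / n.+1%:R : R)^-1.
  rewrite invf_div -[X in X - _](@divff _ (n.+2%:R : R)) ?pnatr_eq0//.
  by rewrite -mulrBl -natrB// subSnn mul1r.
by rewrite e (le_trans (lerD IH h))// -addrA subrKC.
Qed.

End Logarithm.

(** * Fractional cliques and fractional independent sets *)

(** A random set with property [Q]. The free index type lets mixtures on products and unions be
    indexed directly by families or tagged pairs of indices. *)
Record mixture (R : realType) (G : sgraph) (Q : pred {set G}) := Mixture {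
  mix_index : finType;
  mix_law : fdist R mix_index;
  mix_set : mix_index -> {set G};
  mix_setP : forall i, Q (mix_set i) }.

Arguments mix_index {R G Q}.
Arguments mix_law {R G Q}.
Arguments mix_set {R G Q}.
Arguments mix_setP {R G Q}.

(** Absolute continuity: it keeps the default values of [ln] out of [xent p b]. *)
Definition dominates (R : realType) (T : finType) (p b : T -> R) :=
  forall x, 0 < p x -> 0 < b x.

Section Mixtures.
Variable R : realType.
Local Notation mixture := (mixture R).

(** The probability that the random set contains [v]: a coordinate of a point in the convex hull of
    the indicators. *)
Definition mix_pt (G : sgraph) (Q : pred {set G}) (m : mixture Q) (v : G) : R :=
  \sum_(i | v \in mix_set m i) mix_law m i.

Lemma mix_pt_ge0 (G : sgraph) (Q : pred {set G}) (m : mixture Q) v : 0 <= mix_pt m v.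
Proof. by apply: sumr_ge0 => i _; exact: fdist_ge0. Qed.

Lemma mix_pt_le1 (G : sgraph) (Q : pred {set G}) (m : mixture Q) v : mix_pt m v <= 1.
Proof. exact: fdist_le1. Qed.

Lemma sum_mix_pt (G : sgraph) (Q : pred {set G}) (m : mixture Q) (f : G -> R) :
  \sum_v mix_pt m v * f v = \sum_i mix_law m i * \sum_(v in mix_set m i) f v.
Proof.
under eq_bigr do rewrite mulr_suml big_mkcond.
rewrite exchange_big /=; apply: eq_bigr => i _.
by rewrite -big_mkcond mulr_sumr.
Qed.

(** Its lower bound is 0, so it serves for nonnegativity of entropies and as a first admissible
    fractional clique. *)
Definition point_mixture (G : pgraph R) : mixture (@is_clique G) :=
  @Mixture R G (@is_clique G) G (pdist G) (fun v => [set v]) (@is_clique1 G).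

Lemma point_mixtureE (G : pgraph R) v : mix_pt (point_mixture G) v = pdist G v.
Proof. by rewrite /mix_pt/=; under eq_bigl do rewrite inE eq_sym; rewrite big_pred1_eq. Qed.

(** The left side is the expected size of the intersection of [S] with a random clique, which has at
    most one element. *)
Lemma clique_le1 (G : sgraph) (m : mixture (@is_clique G)) (S : {set G}) :
  independent S -> \sum_(v in S) mix_pt m v <= 1.
Proof.
move=> iS; have := sum_mix_pt m (fun v => (v \in S)%:R).
rewrite (eq_bigr (fun v => if v \in S then mix_pt m v else 0)); last first.
  by move=> v _; case: ifP; rewrite ?mulr1 ?mulr0.
rewrite -big_mkcond => -> /=; rewrite -[leRHS](fdist_sum1 (mix_law m)); apply: ler_sum => i _.
rewrite ler_piMr ?fdist_ge0// -natr_sum lern1.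
apply: leq_trans (card_cliqueI (mix_setP m i) iS); rewrite -sum1_card.
rewrite [leqRHS](eq_bigl (fun v => (v \in mix_set m i) && (v \in S))).
  by rewrite big_mkcondr leq_sum// => v _; case: (v \in S).
by move=> v; rewrite inE andbC.
Qed.

Lemma weak_duality (G : sgraph) (a : mixture (@is_clique G))
  (b : mixture (@independent G)) : \sum_v mix_pt a v * mix_pt b v <= 1.
Proof.
under eq_bigr do rewrite mulrC.
rewrite sum_mix_pt -[leRHS](fdist_sum1 (mix_law b)); apply: ler_sum => i _.
by rewrite ler_piMr ?fdist_ge0// clique_le1// mix_setP.
Qed.

Lemma clique_le_entropy (G : pgraph R) (a : mixture (@is_clique G)) (C : finType)
  (c : G -> C) : is_coloring c -> dominates (pdist G) (mix_pt a) ->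
  xent (pdist G) (mix_pt a) - xent (pdist G) (pdist G) <=
  entropy (Defs.pushforward c (pdist G)) * ln 2.
Proof.
move=> cP da; rewrite entropyE divfK ?gt_eqF ?ln2_gt0//.
set P := pdist G; set r := Defs.pushforward c P.
have r0 x : 0 < P x -> 0 < r (c x).
  by move=> Px; apply: lt_le_trans Px _; exact: le_pushforward.
have -> : xent r r = xent P (fun v => r (c v)) by exact: sum_pushforward.
pose s v := mix_pt a v * r (c v).
have s_le1 : \sum_v s v <= 1.
  rewrite (partition_big c predT)//= -[leRHS](fdist_sum1 P).
  rewrite -(sum_pushforward1 c); apply: ler_sum => z _.
  rewrite (eq_bigr (fun v => mix_pt a v * r z)); last by move=> v /eqP <-.
  rewrite -mulr_suml ler_piMl ?pushforward_ge0//.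
  rewrite (eq_bigl [in [set v | c v == z]]); last by move=> v; rewrite inE.
  apply: clique_le1; apply/forall_inP => x; rewrite inE => /eqP xz.
  apply/forall_inP => y; rewrite inE => /eqP yz; apply/negP => xy.
  by move/forallP/(_ x)/forallP/(_ y): cP; rewrite xy xz yz eqxx.
have : xent P s <= xent P P.
  apply: gibbs => [v|v|v Pv|]; rewrite ?fdist_sum1// ?fdist_ge0//.
    by rewrite mulr_ge0 ?mix_pt_ge0 ?pushforward_ge0.
  by rewrite mulr_gt0 ?da ?r0.
rewrite xent_mulr => [h||//|//]; last exact: fdist_ge0.
by move: h; lra.
Qed.

Lemma entropy_ge0 (G : pgraph R) (C : finType) (c : G -> C) : is_coloring c ->
  0 <= entropy (Defs.pushforward c (pdist G)).
Proof.
move=> cP; rewrite -(pmulr_lge0 _ (ln2_gt0 R)).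
have := clique_le_entropy (a := point_mixture G) cP.
rewrite (eq_xent (c := pdist G)); last by move=> v _; exact: point_mixtureE.
rewrite subrr; apply => v; by rewrite point_mixtureE.
Qed.

(* With [j] sets already chosen, a random next set covers [v] with probability
   [b v]; by Jensen's inequality [ln (j + 1 / b v)], an upper bound for the expected
   logarithm of the final colour of [v], does not increase on average. Hence some
   set does not increase the total, and it must meet the uncovered part [U]. *)
Lemma greedy_ordering (G : sgraph) (P : G -> R) (m : mixture (@independent G))
    (U : {set G}) (j : nat) : (forall v, 0 <= P v) -> dominates P (mix_pt m) ->
  exists J : G -> nat, [/\ forall v, v \in U -> (j < J v <= j + #|U|)%N,
    {in U &, forall u v, J u = J v -> ~~ adj u v} &
    \sum_(v in U) P v * ln (J v)%:R <=
    \sum_(v in U) P v * ln (j%:R + (mix_pt m v)^-1)].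
Proof.
move=> P0 dm; have [n] := ubnP #|U|; elim: n U j => // n IH U j; rewrite ltnS => Un.
set b := mix_pt m in dm *.
(* If [U] has no mass, nothing forces a chosen set to meet [U]; both totals are 0, so its vertices
   simply get distinct numbers after [j]. *)
have [/forall_inP PU0|] := boolP [forall v in U, P v == 0].
  exists (fun v => j.+1 + index v (enum U))%N; split.
  - by move=> v vU; rewrite addSn ltnS leq_addr/= -addnS leq_add2l cardE index_mem mem_enum.
  - move=> u v uU vU /addnI e; have -> : u = v; last by rewrite adj_irr.
    by rewrite -[u](nth_index u (s := enum U)) ?mem_enum// e nth_index ?mem_enum.
  - by rewrite !big1// => v /PU0/eqP ->; rewrite mul0r.
rewrite negb_forall_in => /exists_inP[v0 v0U Pv0].
have {}Pv0 : 0 < P v0 by rewrite lt_def Pv0 P0.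
pose f v := P v * ln (j.+1%:R + (b v)^-1).
(* The updated total if set [i] comes next: a covered vertex pays for its number [j + 1], the others
   pay the bound for [j + 1] chosen sets. *)
pose X i := \sum_(v in U) if v \in mix_set m i then P v * ln j.+1%:R else f v.
have [i Xi] := le_mean (mix_law m) X.
have {}Xi : X i <= \sum_(v in U) P v * ln (j%:R + (b v)^-1).
  apply: le_trans Xi _; under eq_bigr do rewrite mulr_sumr.
  rewrite exchange_big /=; apply: ler_sum => v _.
  under eq_bigr do rewrite (fun_if (fun t => _ * t)).
  rewrite (bigID (fun i => v \in mix_set m i))/=.
  rewrite (eq_bigr (fun i => mix_law m i * (P v * ln j.+1%:R))); last by move=> i' ->.
  rewrite [X in _ + X](eq_bigr (fun i => mix_law m i * f v)); last by move=> i' /negPf ->.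
  rewrite -!mulr_suml -/(mix_pt m v) -/(b v).
  have -> : \sum_(i | v \notin mix_set m i) mix_law m i = 1 - b v.
    apply/eqP; rewrite eq_sym subr_eq -(fdist_sum1 (mix_law m)) addrC.
    by rewrite (bigID (fun i => v \in mix_set m i)).
  have [Pv|Pv] := boolP (0 < P v); last first.
    have Pv0' : P v = 0 by apply/eqP; rewrite eq_le P0 andbT leNgt.
    by rewrite /f Pv0' !(mul0r, mulr0) addr0.
  rewrite /f mulrCA [X in _ + X]mulrCA -mulrDr ler_pM2l//.
  have bv := dm _ Pv; have b1 : b v <= 1 by exact: mix_pt_le1.
  set y := j%:R + (b v)^-1.
  have y0 : 0 < y by rewrite ltr_wpDl// invr_gt0.
  (* Jensen by the tangent of [ln] at [y], which is exactly the mean of the two possible arguments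
     [j + 1] and [j + 1 + 1 / b v]. *)
  have tangent z : 0 < z -> ln z <= ln y + (z / y - 1).
    by move=> z0; rewrite -lerBlDl -ln_div ?posrE// ln_le_sub1// divr_gt0.
  have z1 : 0 < j.+1%:R :> R by rewrite ltr0n.
  have z2 : 0 < j.+1%:R + (b v)^-1 by rewrite addr_gt0 ?invr_gt0.
  apply: (le_trans (lerD (ler_wpM2l (ltW bv) (tangent _ z1))
                         (ler_wpM2l (_ : 0 <= 1 - b v) (tangent _ z2)))).
    by rewrite subr_ge0.
  have e : b v * j.+1%:R + (1 - b v) * (j.+1%:R + (b v)^-1) = y.
    by rewrite /y -natr1; field; rewrite gt_eqF.
  rewrite le_eqVlt; apply/orP; left; apply/eqP.
  transitivity (ln y + ((b v * j.+1%:R + (1 - b v) * (j.+1%:R + (b v)^-1)) / y - 1)).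
    by ring.
  by rewrite e divff ?gt_eqF// subrr addr0.
pose U' := U :\: mix_set m i.
have f_gt v : 0 < P v -> P v * ln (j%:R + (b v)^-1) < f v.
  move=> Pv; have bv : 0 < (b v)^-1 by rewrite invr_gt0 dm.
  by rewrite ltr_pM2l// ltr_ln ?posrE ?ltrD2r ?ltr_nat// ltr_wpDl.
have f_ge v : P v * ln (j%:R + (b v)^-1) <= f v.
  have [/f_gt/ltW//|Pv] := boolP (0 < P v).
  have Pv0' : P v = 0 by apply/eqP; rewrite eq_le P0 andbT leNgt.
  by rewrite /f Pv0' !mul0r.
(* A set missing [U] would replace every term by [f v], strictly larger at [v0], so the total would
   increase. *)
have U'U : (#|U'| < #|U|)%N.
  rewrite proper_card// properE subsetDl /=; apply/negP => UU'.
  move: Xi; apply/negP; rewrite -ltNge /X [ltRHS](eq_bigr f); last first.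
    by move=> v /(fintype.subsetP UU'); rewrite inE => /andP[/negPf ->].
  rewrite (bigD1 v0)//= [ltRHS](bigD1 v0)//= ltr_leD ?f_gt//.
  by apply: ler_sum.
have [|J' [J'U J'c J'le]] := IH U' j.+1; first exact: leq_trans U'U Un.
exists (fun v => if v \in mix_set m i then j.+1 else J' v); split.
- move=> v vU; case: ifPn => vi.
    by rewrite ltnSn -addn1 leq_add2l card_gt0; apply/set0Pn; exists v.
  have /J'U/andP[jJ Jj] : v \in U' by rewrite inE vi.
  by rewrite (ltnW jJ) (leq_trans Jj)// addSn -addnS leq_add2l.
- move=> u v uU vU; case: ifPn => ui; case: ifPn => vi.
  + have /forall_inP/(_ _ ui)/forall_inP/(_ _ vi) := mix_setP m i; by [].
  + have /J'U/andP[+ _] : v \in U' by rewrite inE vi.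
    by move=> /[swap] <-; rewrite ltnn.
  + have /J'U/andP[+ _] : u \in U' by rewrite inE ui.
    by move=> /[swap] ->; rewrite ltnn.
  + by apply: J'c; rewrite inE ?ui ?vi.
- apply: le_trans Xi; rewrite /X.
  rewrite (bigID (fun v => v \in mix_set m i))/= [leRHS](bigID (fun v => v \in mix_set m i))/=.
  apply: lerD; first by apply: ler_sum => v /andP[_ ->].
  have U'E v : (v \in U) && (v \notin mix_set m i) = (v \in U') by rewrite inE andbC.
  rewrite (eq_bigl _ _ U'E) [leRHS](eq_bigl _ _ U'E).
  rewrite [leRHS](eq_bigr f) => [|v]; last by rewrite inE => /andP[/negPf ->].
  apply: le_trans J'le; rewrite le_eqVlt; apply/orP; left; apply/eqP.
  by apply: eq_bigr => v; rewrite inE => /andP[/negPf ->].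
Qed.

(** Gibbs' inequality against the weights [1 / (z * h)] bounds the entropy of a positive integer
    colour [z] by the mean of [ln z] plus [ln h]; the harmonic sum dictates [h]. *)
Lemma exists_coloring (G : pgraph R) (b : mixture (@independent G)) :
  dominates (pdist G) (mix_pt b) ->
  exists (C : finType) (c : G -> C), is_coloring c /\
    entropy (Defs.pushforward c (pdist G)) * ln 2 <=
    - xent (pdist G) (mix_pt b) + ln (1 + ln #|G|%:R).
Proof.
set P := pdist G => db.
have [J [JT Jc Jle]] := greedy_ordering (finset.setT : {set G}) 0 (fdist_ge0 P) db.
pose N := #|G|; pose c v : 'I_N.+1 := inord (J v).
have cE v : c v = J v :> nat.
  by rewrite inordK// ltnS; have := JT v (finset.in_setT _); rewrite cardsT => /andP[].
exists 'I_N.+1, c; split.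
  apply/'forall_forallP => x y; apply/implyP => xy; apply/negP => /eqP exy.
  by have := Jc x y (finset.in_setT _) (finset.in_setT _); rewrite -!cE exy xy => /(_ erefl).
rewrite entropyE divfK ?gt_eqF ?ln2_gt0//; set r := Defs.pushforward c P.
have N_gt0 : (0 < N)%N.
  rewrite lt0n; apply/eqP => N0; have := fdist_sum1 P.
  rewrite big1 => [/eqP|v]; first by rewrite eq_sym oner_eq0.
  by move: N0 => /card0_eq/(_ v).
pose h : R := 1 + ln N%:R.
have h_gt0 : 0 < h by rewrite ltr_pwDl// ln_ge0// ler1n.
have r0 z : r z != 0 -> (0 < z)%N.
  apply: contra_neqT; rewrite -eqn0Ngt => /eqP z0.
  apply: big1 => v /eqP vz; have := JT v (finset.in_setT _).
  by rewrite -cE vz z0.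
have r_gt0 z : 0 < r z -> (0 < z)%N by move=> /lt0r_neq0/r0.
pose s1 (z : 'I_N.+1) : R := z%:R^-1.
have s1_ge0 z : 0 <= s1 z by rewrite invr_ge0.
have : xent r (fun z => s1 z * h^-1) <= xent r r.
  apply: gibbs => [z|z|z /r_gt0 z0|].
  - exact: pushforward_ge0.
  - by rewrite mulr_ge0 ?invr_ge0// ltW.
  - by rewrite mulr_gt0 ?invr_gt0 ?ltr0n.
  - rewrite sum_pushforward1 fdist_sum1 -mulr_suml ler_pdivrMr// mul1r.
    (* Colour 0 has weight [0^-1 = 0], which leaves exactly the harmonic sum up to [N]. *)
    rewrite big_ord_recl /s1 invr0 add0r; exact: harmonic_le_ln.
have sumr1 : \sum_z r z = 1 by rewrite sum_pushforward1 fdist_sum1.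
rewrite xent_mulr; first last.
- by move=> z _; rewrite invr_gt0.
- by move=> z /r_gt0 z0; rewrite invr_gt0 ltr0n.
- exact: pushforward_ge0.
have -> : xent r (fun=> h^-1) = - ln h.
  by rewrite /xent -mulr_suml sumr1 mul1r lnV.
have -> : xent r s1 = - xent P (fun v => (J v)%:R).
  rewrite {1}/xent sum_pushforward -sumrN; apply: eq_bigr => v _.
  rewrite /s1 cE lnV ?mulrN// posrE ltr0n.
  by have := JT v (finset.in_setT _) => /andP[].
have : xent P (fun v => (J v)%:R) <= - xent P (mix_pt b).
  rewrite -xentV => [||//]; last exact: fdist_ge0.
  have sumT (f : G -> R) : \sum_(v in (finset.setT : {set G})) f v = \sum_v f v.
    by apply: eq_bigl => v; rewrite finset.in_setT.
  by move: Jle; rewrite !sumT; under [leRHS]eq_bigr do rewrite add0r.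
by rewrite -/h -/N; lra.
Qed.

End Mixtures.

(** * AND products and disjoint unions *)

Section ProductLaw.
Variables (R : realType) (I : finType) (T : I -> finType).

(** Distributivity for dependent choices; [fprod] recasts them as functions into a tagged sum, where
    the non-dependent law applies. *)
Lemma sum_dffun_prod (F : forall i, T i -> R) :
  \sum_(f : {dffun forall i, T i}) \prod_i F i (f i) = \prod_i \sum_x F i x.
Proof.
rewrite (reindex (@dffun_of_fprod I T)); last exact/onW_bij/dffun_of_fprod_bij.
pose F_ i := [ffun x : T i => F i x].
transitivity (\sum_(t : fprod T) \prod_(i in I) F_ i (t i)).
  by apply: eq_bigr => t _; apply: eq_bigr => i _; rewrite !ffunE.
rewrite big_fprod -(bigA_distr_big_dep _ (fun i x => untag 0 (F_ i) x)).
apply: eq_bigr => i _; rewrite [RHS](eq_bigr (F_ i)) => [|x _]; last by rewrite ffunE.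
exact: (esym (big_tag (fun i => F_ i) i)).
Qed.

Variable q : forall i, fdist R (T i).

Definition prod_law (f : {dffun forall i, T i}) : R := \prod_i q i (f i).

Lemma prod_law_ge0 f : 0 <= prod_law f.
Proof. by apply: prodr_ge0 => i _; exact: fdist_ge0. Qed.

Lemma prod_law_sum1 : \sum_f prod_law f = 1.
Proof. by rewrite (sum_dffun_prod (fun i x => q i x)) big1// => i _; exact: fdist_sum1. Qed.

Definition prod_fdist : fdist R {dffun forall i, T i} :=
  FDist prod_law_ge0 prod_law_sum1.

Lemma prod_law_marginal (phi : forall i, T i -> R) j :
  \sum_f prod_law f * phi j (f j) = \sum_x q j x * phi j x.
Proof.
pose F i x := q i x * (if i == j then phi i x else 1).
transitivity (\sum_(f : {dffun forall i, T i}) \prod_i F i (f i)).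
  apply: eq_bigr => f _; rewrite big_split/=; congr (_ * _).
  by rewrite (bigD1 j)//= eqxx big1 ?mulr1// => i /negPf ->.
rewrite sum_dffun_prod (bigD1 j)//= [X in _ * X]big1 ?mulr1.
  by apply: eq_bigr => x _; rewrite /F eqxx.
move=> i /negPf ij; rewrite -[RHS](fdist_sum1 (q i)).
by apply: eq_bigr => x _; rewrite /F ij mulr1.
Qed.

Lemma ln_prod (b : I -> R) : (forall i, 0 < b i) ->
  ln (\prod_i b i) = \sum_i ln (b i).
Proof.
move=> b0; suff [] : 0 < \prod_i b i /\ ln (\prod_i b i) = \sum_i ln (b i) by [].
apply: (big_ind2 (fun x y => 0 < x /\ ln x = y)) => [|x x' y y' [x0 <-] [y0 <-]|//].
  by rewrite ln1.
by rewrite mulr_gt0// lnM.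
Qed.

Lemma prod_law_gt0 f : (0 < prod_law f) = [forall i, 0 < q i (f i)].
Proof.
apply/idP/forallP => [f0 i|f0]; last by apply: prodr_gt0 => i _.
rewrite lt_def fdist_ge0 andbT; apply: contraTneq f0 => qi.
by rewrite /prod_law (bigD1 i)//= qi mul0r ltxx.
Qed.

Lemma xent_prod (b : forall i, T i -> R) : (forall i, dominates (q i) (b i)) ->
  xent prod_law (fun f => \prod_i b i (f i)) = \sum_i xent (q i) (b i).
Proof.
move=> qb; transitivity (\sum_f \sum_i prod_law f * ln (b i (f i))).
  apply: eq_bigr => f _; rewrite -mulr_sumr.
  have [/eqP ->|f0] := boolP (prod_law f == 0); first by rewrite !mul0r.
  have {}f0 : 0 < prod_law f by rewrite lt_def f0 prod_law_ge0.
  by rewrite ln_prod// => i; move: f0; rewrite prod_law_gt0 => /forallP/(_ i)/qb.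
rewrite exchange_big /=; apply: eq_bigr => i _.
exact: (prod_law_marginal (fun i x => ln (b i x))).
Qed.

End ProductLaw.

(** * Mixtures on AND products *)

Section AndProductMixture.
Variables (R : realType) (A : finType) (G : A -> pgraph R).

Definition and_set (S : forall a, {set G a}) : {set and_prod G} :=
  [set v | [forall a, (v : {dffun forall a, G a}) a \in S a]].

Lemma and_set_clique S : (forall a, is_clique (S a)) -> is_clique (and_set S).
Proof.
move=> cS; apply/forall_inP => v; rewrite inE => /forallP vS.
apply/forall_inP => w; rewrite inE => /forallP wS; apply/implyP => vw.
rewrite /= /and_adj vw; apply/forallP => a; rewrite -implyNb; apply/implyP.
by move/forall_inP/(_ _ (vS a))/forall_inP/(_ _ (wS a))/implyP: (cS a); apply.
Qed.

(** Inside such a box no coordinate can be adjacent, so adjacency would force equality in every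
    coordinate. *)
Lemma and_set_independent S : (forall a, independent (S a)) -> independent (and_set S).
Proof.
move=> iS; apply/forall_inP => v; rewrite inE => /forallP vS.
apply/forall_inP => w; rewrite inE => /forallP wS; rewrite /= /and_adj negb_and negbK.
have [//|vw] := eqVneq v w; apply: contraNN vw => /forallP vw.
apply/eqP/ffunP => a; have /orP[/eqP//|] := vw a.
by move/forall_inP/(_ _ (vS a))/forall_inP/(_ _ (wS a)): (iS a) => /negPf ->.
Qed.

Variables (Q : forall a, pred {set G a}) (Q' : pred {set and_prod G}).
Hypothesis QQ' : forall S, (forall a, Q (S a)) -> Q' (and_set S).
Variable m : forall a, mixture R (@Q a).

(** Independent draws in the factors; the parameters [Q] and [Q'] let one construction serve cliques
    and independent sets. *)
Definition and_mixture : mixture R Q' :=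
  @Mixture R (and_prod G) Q' _ (prod_fdist (fun a => mix_law (m a)))
    (fun f => and_set (fun a => mix_set (m a) (f a)))
    (fun f => QQ' (fun a => mix_setP (m a) (f a))).

Lemma and_mixtureE v : mix_pt and_mixture v = \prod_a mix_pt (m a) (v a).
Proof.
rewrite /mix_pt; under [RHS]eq_bigr do rewrite big_mkcond.
rewrite -sum_dffun_prod big_mkcond; apply: eq_bigr => f _; rewrite inE.
case: ifPn => [/forallP vS|]; first by apply: eq_bigr => a _; rewrite vS.
by rewrite negb_forall => /existsP[a /negPf va]; rewrite (bigD1 a)//= va mul0r.
Qed.

Hypothesis dm : forall a, dominates (pdist (G a)) (mix_pt (m a)).

Lemma and_mixture_dominates : dominates (pdist (and_prod G)) (mix_pt and_mixture).
Proof.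
move=> v /=; rewrite and_mixtureE.
rewrite -[and_prob v]/(prod_law (fun a => pdist (G a)) v) prod_law_gt0 => /forallP v0.
by apply: prodr_gt0 => a _; exact: dm.
Qed.

Lemma xent_and_mixture : xent (pdist (and_prod G)) (mix_pt and_mixture) =
  \sum_a xent (pdist (G a)) (mix_pt (m a)).
Proof.
rewrite -(xent_prod dm); apply: eq_bigr => v _.
by congr (_ * ln _); exact: and_mixtureE.
Qed.

End AndProductMixture.

Lemma xent_and_prod (R : realType) (A : finType) (G : A -> pgraph R) :
  xent (pdist (and_prod G)) (pdist (and_prod G)) =
  \sum_a xent (pdist (G a)) (pdist (G a)).
Proof. exact: (@xent_prod R A _ (fun a => pdist (G a)) _ (fun a v Pv => Pv)). Qed.

(** * Mixtures on disjoint unions *)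

Section UnionMixture.
Variables (R : realType) (A : finType) (PA : fdist R A) (G : A -> pgraph R).
Let U := disjoint_union PA G.

Lemma Tagged_set_clique a (S : {set G a}) : is_clique S ->
  @is_clique U [set Tagged (fun a => G a : finType) v | v in S].
Proof.
move=> /forall_inP cS; apply/forall_inP => _ /imsetP[v vS ->].
apply/forall_inP => _ /imsetP[w wS ->]; apply/implyP => vw.
rewrite /= /union_adj /= eqxx tagged_asE /=.
have /forall_inP/(_ _ wS)/implyP := cS _ vS; apply.
by apply: contraNneq vw => ->.
Qed.

Variable a : forall i, mixture R (@is_clique (G i)).

Let I := {i : A & mix_index (a i)}.

(** A nonempty clique lies in a single component: the component is drawn from [PA], then a clique in
    it. *)
Definition union_law (z : I) : R := PA (tag z) * mix_law (a (tag z)) (tagged z).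

Lemma union_law_ge0 z : 0 <= union_law z.
Proof. by rewrite mulr_ge0 ?fdist_ge0. Qed.

Lemma union_law_sum1 : \sum_z union_law z = 1.
Proof.
rewrite -(sig_big_dep xpredT (fun _ _ => true) (fun i x => PA i * mix_law (a i) x)) /=.
rewrite -[RHS](fdist_sum1 PA); apply: eq_bigr => i _.
by rewrite -mulr_sumr fdist_sum1 mulr1.
Qed.

Definition union_clique : mixture R (@is_clique U) :=
  @Mixture R U (@is_clique U) I (FDist union_law_ge0 union_law_sum1) _
    (fun z => Tagged_set_clique (mix_setP (a (tag z)) (tagged z))).

Lemma union_cliqueE w :
  mix_pt union_clique w = PA (tag w) * mix_pt (a (tag w)) (tagged w).
Proof.
case: w => k u; rewrite /mix_pt/= /union_law; set w := Tagged (fun a => G a : finType) u.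
rewrite -(sig_big_dep xpredT (fun i x => w \in [set Tagged (fun a => G a : finType) v | v in mix_set (a i) x])
  (fun i x => PA i * mix_law (a i) x)) /=.
rewrite (bigD1 k)//= [X in _ + X]big1 ?addr0 => [|i iw]; last first.
  by rewrite big_pred0// => x; apply/imsetP => -[v _ [e _]]; rewrite e eqxx in iw.
rewrite -mulr_sumr; congr (_ * _); apply: eq_bigl => x.
by rewrite mem_imset//; exact: eq_from_Tagged.
Qed.

Variable b : forall i, mixture R (@independent (G i)).

(** An independent set may use all components at once, so one set is drawn in each; hence no factor
    [PA] in [union_indepE]. *)
Definition union_indep_set (f : {dffun forall i, mix_index (b i)}) : {set U} :=
  [set w : {i : A & G i} | tagged w \in mix_set (b (tag w)) (f (tag w))].

Lemma union_indep_setP f : independent (union_indep_set f).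
Proof.
apply/forall_inP => -[i v]; rewrite inE /= => vS.
apply/forall_inP => -[j w]; rewrite inE /= => wS.
rewrite /union_adj /=; have [ij|//] := eqVneq i j; case: j / ij w wS => w wS.
rewrite tagged_asE /=.
by move/forall_inP/(_ _ vS)/forall_inP/(_ _ wS): (mix_setP (b i) (f i)).
Qed.

Definition union_indep : mixture R (@independent U) :=
  @Mixture R U (@independent U) _ (prod_fdist (fun i => mix_law (b i)))
    union_indep_set union_indep_setP.

Lemma union_indepE w : mix_pt union_indep w = mix_pt (b (tag w)) (tagged w).
Proof.
case: w => k u; rewrite /mix_pt/= big_mkcond /=.
have Tinj i : injective (Tagged (fun a => G a : finType) (i := i)).
  exact: eq_from_Tagged.
set w := Tagged (fun a => G a : finType) u.
pose phi i (x : mix_index (b i)) : R :=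
  (w \in [set Tagged (fun a => G a : finType) v | v in mix_set (b i) x])%:R.
have phiE x : phi k x = (u \in mix_set (b k) x)%:R by rewrite /phi mem_imset.
transitivity (\sum_f prod_law (fun i => mix_law (b i)) f * phi k (f k)).
  by apply: eq_bigr => f _; rewrite phiE inE; case: ifP; rewrite ?mulr1 ?mulr0.
rewrite prod_law_marginal [RHS]big_mkcond; apply: eq_bigr => x _.
by rewrite phiE; case: ifP; rewrite ?mulr1 ?mulr0.
Qed.

Lemma xent_union (f : forall i, G i -> R) :
  xent (pdist U) (fun w => f (tag w) (tagged w)) =
  \sum_i PA i * xent (pdist (G i)) (f i).
Proof.
rewrite /xent /= /union_prob.
rewrite -(sig_big_dep xpredT (fun _ _ => true)
  (fun i x => PA i * pdist (G i) x * ln (f i x))) /=.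
by apply: eq_bigr => i _; rewrite mulr_sumr; apply: eq_bigr => x _; rewrite mulrA.
Qed.

Lemma union_gt0 w : 0 < pdist U w ->
  0 < PA (tag w) /\ 0 < pdist (G (tag w)) (tagged w).
Proof.
rewrite /= /union_prob; have [/eqP ->|p0] := boolP (PA (tag w) == 0).
  by rewrite mul0r ltxx.
have {}p0 : 0 < PA (tag w) by rewrite lt_def p0 fdist_ge0.
by rewrite pmulr_rgt0.
Qed.

(** Applied to the clique mixture and to the distribution of the union, it yields the same term in
    [PA], which cancels in the lower bound. *)
Lemma xent_union_mul (f : forall i, G i -> R) :
  (forall i, dominates (pdist (G i)) (f i)) ->
  xent (pdist U) (fun w => PA (tag w) * f (tag w) (tagged w)) =
  xent (pdist U) (fun w => PA (tag w)) + \sum_i PA i * xent (pdist (G i)) (f i).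
Proof.
move=> df; rewrite xent_mulr ?xent_union//; first exact: fdist_ge0.
- by move=> w /union_gt0[].
- by move=> w /union_gt0[_ /df].
Qed.

End UnionMixture.

(** * Common values of the lower and upper bounds *)

Section Sandwich.
Variable R : realType.

Definition sandwiched (G : pgraph R) (x : R) := forall e, 0 < e ->
  exists (a : mixture R (@is_clique G)) (b : mixture R (@independent G)),
  [/\ dominates (pdist G) (mix_pt a), dominates (pdist G) (mix_pt b),
      x - e <= xent (pdist G) (mix_pt a) - xent (pdist G) (pdist G) &
      - xent (pdist G) (mix_pt b) <= x + e].

Lemma sandwiched_choice (A : finType) (G : A -> pgraph R) (x : A -> R) (e : R) :
  (forall i, sandwiched (G i) (x i)) -> 0 < e ->
  exists (a : forall i, mixture R (@is_clique (G i)))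
    (b : forall i, mixture R (@independent (G i))), forall i,
  [/\ dominates (pdist (G i)) (mix_pt (a i)), dominates (pdist (G i)) (mix_pt (b i)),
      x i - e <= xent (pdist (G i)) (mix_pt (a i)) - xent (pdist (G i)) (pdist (G i)) &
      - xent (pdist (G i)) (mix_pt (b i)) <= x i + e].
Proof.
move=> GS e0; pose a i := cid (GS i e e0); pose b i := cid (projT2 (a i)).
by exists (fun i => projT1 (a i)), (fun i => projT1 (b i)) => i; exact: projT2 (b i).
Qed.

Lemma sandwiched_and (A : finType) (G : A -> pgraph R) (x : A -> R) :
  (forall i, sandwiched (G i) (x i)) -> sandwiched (and_prod G) (\sum_i x i).
Proof.
(* The error is shared among the factors; the successor covers an empty [A]. *)
move=> GS e e0; have e'0 : 0 < e / #|A|.+1%:R by rewrite divr_gt0.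
have [a [b ab]] := sandwiched_choice GS e'0.
have da i : dominates (pdist (G i)) (mix_pt (a i)) by case: (ab i).
have db i : dominates (pdist (G i)) (mix_pt (b i)) by case: (ab i).
exists (and_mixture (@and_set_clique _ _ G) a).
exists (and_mixture (@and_set_independent _ _ G) b).
have sum_e : \sum_(i : A) e / #|A|.+1%:R <= e.
  rewrite sumr_const -[leLHS]mulr_natr -mulrA ler_piMr ?(ltW e0)// mulrC ler_pdivrMr ?ltr0n//.
  by rewrite mul1r ler_nat.
split; [exact: and_mixture_dominates|exact: and_mixture_dominates| |].
- rewrite xent_and_mixture// xent_and_prod -sumrB.
  apply: (@le_trans _ _ (\sum_i (x i - e / #|A|.+1%:R))).
    by rewrite sumrB lerD2l lerN2.
  by apply: ler_sum => i _; case: (ab i).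
- rewrite xent_and_mixture// -sumrN.
  apply: (@le_trans _ _ (\sum_i (x i + e / #|A|.+1%:R))).
    by apply: ler_sum => i _; case: (ab i).
  by rewrite big_split lerD2l.
Qed.

Lemma sandwiched_union (A : finType) (PA : fdist R A) (G : A -> pgraph R) (x : A -> R) :
  (forall i, sandwiched (G i) (x i)) ->
  sandwiched (disjoint_union PA G) (\sum_i PA i * x i).
Proof.
move=> GS e e0; have [a [b ab]] := sandwiched_choice GS e0.
have da i : dominates (pdist (G i)) (mix_pt (a i)) by case: (ab i).
have db i : dominates (pdist (G i)) (mix_pt (b i)) by case: (ab i).
have xa : xent (pdist (disjoint_union PA G)) (mix_pt (union_clique PA a)) =
    xent (pdist (disjoint_union PA G)) (fun w => PA (tag w)) +
    \sum_i PA i * xent (pdist (G i)) (mix_pt (a i)).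
  by rewrite -xent_union_mul//; apply: eq_xent => w _; exact: union_cliqueE.
have xb : xent (pdist (disjoint_union PA G)) (mix_pt (union_indep PA b)) =
    \sum_i PA i * xent (pdist (G i)) (mix_pt (b i)).
  by rewrite -xent_union; apply: eq_xent => w _; exact: union_indepE.
have xp : xent (pdist (disjoint_union PA G)) (pdist (disjoint_union PA G)) =
    xent (pdist (disjoint_union PA G)) (fun w => PA (tag w)) +
    \sum_i PA i * xent (pdist (G i)) (pdist (G i)).
  exact: (@xent_union_mul R A PA G (fun i x => pdist (G i) x) (fun i v Pv => Pv)).
have PAe : \sum_i PA i * e = e by rewrite -mulr_suml fdist_sum1 mul1r.
exists (union_clique PA a), (union_indep PA b); split.
- by move=> w /union_gt0[p0 /da v0]; rewrite union_cliqueE mulr_gt0.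
- by move=> w /union_gt0[_ /db v0]; rewrite union_indepE.
- rewrite xa xp opprD addrACA subrr add0r -sumrB -[in X in X <= _]PAe -sumrB.
  apply: ler_sum => i _; rewrite -!mulrBr ler_wpM2l ?fdist_ge0//.
  by case: (ab i).
- rewrite xb -sumrN -[in X in _ <= X]PAe -big_split.
  apply: ler_sum => i _; rewrite /= -mulrN -mulrDr ler_wpM2l ?fdist_ge0//.
  by case: (ab i).
Qed.

End Sandwich.

(** * Bounds on the graph entropies *)

Section Entropies.
Variable R : realType.

Lemma chromatic_entropy_ge (G : pgraph R) (a : mixture R (@is_clique G)) :
  dominates (pdist G) (mix_pt a) ->
  xent (pdist G) (mix_pt a) - xent (pdist G) (pdist G) <= chromatic_entropy G * ln 2.
Proof.
move=> da; rewrite -ler_pdivrMr ?ln2_gt0//; apply: lb_le_inf.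
  exists (entropy (Defs.pushforward id (pdist G))), G, id; split=> //.
  apply/'forall_forallP => x y; apply/implyP; apply: contraTneq => ->.
  by rewrite adj_irr.
by move=> _ [C [c [cP ->]]]; rewrite ler_pdivrMr ?ln2_gt0// clique_le_entropy.
Qed.

Lemma chromatic_entropy_le (G : pgraph R) (b : mixture R (@independent G)) :
  dominates (pdist G) (mix_pt b) ->
  chromatic_entropy G * ln 2 <= - xent (pdist G) (mix_pt b) + ln (1 + ln #|G|%:R).
Proof.
move=> /exists_coloring[C [c [cP]]]; apply: le_trans.
rewrite ler_pM2r ?ln2_gt0//; apply: ge_inf; last by exists C, c.
by exists 0 => _ [D [d [dP ->]]]; exact: entropy_ge0.
Qed.

(** The tangent bound [ln y <= d * y - 1 - ln d] with a small slope [d]. It makes the additive term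
    of [chromatic_entropy_le] negligible along AND powers. *)
Lemma ln_affine_le (c e : R) : 0 <= c -> 0 < e ->
  exists N : nat, forall n, (N <= n)%N -> ln (1 + n%:R * c) <= n%:R * e.
Proof.
move=> c0 e0; pose d := e / (2 * (c + 1)).
have d0 : 0 < d by rewrite divr_gt0// mulr_gt0// ltr_wpDl.
have dc : d * c <= e / 2.
  rewrite /d -mulrA ler_pM2l// ler_pdivrMl ?mulr_gt0// ?ltr_wpDl//.
  by lra.
(* From [K] on, the constant [d - ln d] costs at most [n * e / 2]; the slope costs the other
   half. *)
pose K := (d - ln d) * 2 / e.
exists (Num.trunc K).+1 => n Kn.
have nK : K <= n%:R.
  have [K0|K0] := leP 0 K; last by rewrite (le_trans (ltW K0)).
  by rewrite ltW// (lt_le_trans (proj2 (andP (truncn_itv K0))))// ler_nat.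
have y0 : 0 < 1 + n%:R * c by rewrite ltr_pwDl// mulr_ge0.
have : ln ((1 + n%:R * c) * d) <= (1 + n%:R * c) * d - 1.
  by rewrite ln_le_sub1// mulr_gt0.
rewrite lnM// => h.
have h1 : d - ln d <= n%:R * e / 2.
  by move: nK; rewrite /K ler_pdivrMr// -ler_pdivlMr.
have h2 : n%:R * (d * c) <= n%:R * (e / 2) by rewrite ler_wpM2l.
lra.
Qed.

Lemma card_and_power (G : pgraph R) n : #|and_power G n| = (#|G| ^ n)%N.
Proof.
rewrite (@card_dep_ffun 'I_n (fun=> G : finType)) -[in RHS](size_enum_ord n).
by rewrite /image_mem; elim: (enum 'I_n) => //= _ s ->; rewrite expnS.
Qed.

Lemma sandwiched_compl_entropy (G : pgraph R) x : sandwiched G x ->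
  compl_graph_entropy G = x / ln 2.
Proof.
move=> GS; apply: cvg_lim; first exact: Rhausdorff.
apply/cvgrPdist_le => eps eps0.
(* One half of the error, in nats, pays for the mixtures and the other for the logarithmic term. *)
have e0 : 0 < eps * ln 2 / 2 by rewrite divr_gt0// mulr_gt0// ln2_gt0.
have [a [b [da db xa xb]]] := GS _ e0.
pose c : R := ln #|G|%:R.
have c0 : 0 <= c by case: (#|G|) @c => [|k]/=; [rewrite ln0|rewrite ln_ge0 ?ler1n].
have [N HN] := ln_affine_le c0 e0.
exists N.+1 => // n /= Nn; have n0 : (0 < n)%N by exact: leq_trans Nn.
pose m := and_mixture (A := 'I_n) (G := fun=> G) (@and_set_clique _ _ _) (fun=> a).
pose m' := and_mixture (A := 'I_n) (G := fun=> G) (@and_set_independent _ _ _) (fun=> b).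
have dm : dominates (pdist (and_power G n)) (mix_pt m) by exact: and_mixture_dominates.
have dm' : dominates (pdist (and_power G n)) (mix_pt m') by exact: and_mixture_dominates.
have lo := chromatic_entropy_ge dm; have up := chromatic_entropy_le dm'.
set h := chromatic_entropy _ in lo up *.
rewrite /m xent_and_mixture// xent_and_prod !sumr_const card_ord in lo.
rewrite /m' xent_and_mixture// sumr_const card_ord card_and_power natrX in up.
set E := eps * ln 2 / 2 in e0 xa xb HN.
have G0 : (0 < #|G|)%N.
  rewrite lt0n; apply/eqP => N0; have := fdist_sum1 (pdist G).
  rewrite big1 => [/eqP|v]; first by rewrite eq_sym oner_eq0.
  by move: N0 => /card0_eq/(_ v).
rewrite lnXn ?ltr0n// -/c -(mulr_natl c) in up.
have {}HN := HN _ (ltnW Nn).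
have n0' : 0 < n%:R :> R by rewrite ltr0n.
have lo' : n%:R * (x - E) <= h * ln 2.
  by apply: le_trans lo; rewrite -mulrnBl -[leRHS]mulr_natl ler_pM2l.
have up' : h * ln 2 <= n%:R * (x + E + E).
  apply: le_trans up _; rewrite -mulNrn -[X in X + _ <= _]mulr_natl (mulrDr _ (x + E)) lerD//.
  by rewrite ler_pM2l.
have l2 := ln2_gt0 R.
have -> : x / ln 2 - h / n%:R = (n%:R * x - h * ln 2) / (n%:R * ln 2).
  by field; rewrite !gt_eqF.
rewrite normrM normfV (gtr0_norm (mulr_gt0 n0' l2)) ler_pdivrMr ?mulr_gt0//.
have -> : eps * (n%:R * ln 2) = n%:R * (E + E) by rewrite /E; field.
by rewrite ler_norml; lra.
Qed.

(** By [weak_duality] the pointwise product of the two mixtures is a subprobability, to which Gibbs'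
    inequality applies. *)
Lemma weak_duality_xent (G : pgraph R) (a : mixture R (@is_clique G))
    (b : mixture R (@independent G)) :
  dominates (pdist G) (mix_pt a) -> dominates (pdist G) (mix_pt b) ->
  xent (pdist G) (mix_pt a) - xent (pdist G) (pdist G) <= - xent (pdist G) (mix_pt b).
Proof.
move=> da db; set P := pdist G.
have : xent P (fun v => mix_pt a v * mix_pt b v) <= xent P P.
  apply: gibbs => [v|v|v Pv|]; first exact: fdist_ge0.
  - by rewrite mulr_ge0 ?mix_pt_ge0.
  - by rewrite mulr_gt0 ?da ?db.
  - by rewrite fdist_sum1 weak_duality.
rewrite xent_mulr//; last exact: fdist_ge0.
by lra.
Qed.

(** * Mutual information and Körner entropy *)

Lemma mutual_infoE (T U : finType) (p : fdist R (T * U)%type) :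
  mutual_info p * ln 2 = xent p p -
   xent p (fun z => Defs.pushforward fst p z.1 * Defs.pushforward snd p z.2).
Proof.
rewrite /mutual_info mulr_suml -sumrB; apply: eq_bigr => z _.
have [/eqP ->|pz] := boolP (p z == 0); first by rewrite !mul0r subrr.
have {}pz : 0 < p z by rewrite lt_def pz fdist_ge0.
rewrite /log2 mulrA divfK ?gt_eqF ?ln2_gt0// -mulrBr.
have q1 : 0 < Defs.pushforward fst p z.1 by apply: lt_le_trans pz _; exact: le_pushforward.
have q2 : 0 < Defs.pushforward snd p z.2 by apply: lt_le_trans pz _; exact: le_pushforward.
by rewrite ln_div// posrE mulr_gt0.
Qed.

Section JointLaw.
Variables (G : pgraph R) (K : G -> fdist R (indep_sets G)).

Lemma joint_law_ge0 z : 0 <= joint_law K z.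
Proof. by rewrite mulr_ge0 ?fdist_ge0. Qed.

Lemma joint_law_sum2 v : \sum_W joint_law K (W, v) = pdist G v.
Proof. by rewrite /joint_law/= -mulr_sumr fdist_sum1 mulr1. Qed.

Lemma joint_law_sum1 : \sum_z joint_law K z = 1.
Proof.
rewrite (eq_bigr (fun z => joint_law K (z.1, z.2))); last by case.
rewrite -(pair_bigA _ (fun W v => joint_law K (W, v))) exchange_big/=.
by under eq_bigr do rewrite joint_law_sum2; exact: fdist_sum1.
Qed.

Definition joint_fdist : fdist R (indep_sets G * G)%type :=
  FDist joint_law_ge0 joint_law_sum1.

Lemma joint_law_snd v : Defs.pushforward snd (joint_law K) v = pdist G v.
Proof.
rewrite -joint_law_sum2 /Defs.pushforward.
rewrite (reindex_onto (fun W => (W, v)) fst)/=; last by case=> W u /= /eqP ->.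
by apply: eq_bigl => W; rewrite !eqxx.
Qed.

End JointLaw.

(** The mixture is the marginal law of the random independent set; it covers [v] with probability at
    least [P v], hence dominates. *)
Lemma mutual_info_ge (G : pgraph R) (K : G -> fdist R (indep_sets G)) :
  \sum_(wv : indep_sets G * G | wv.2 \in val wv.1) joint_law K wv = 1 ->
  exists2 b : mixture R (@independent G), dominates (pdist G) (mix_pt b) &
    - xent (pdist G) (mix_pt b) <= mutual_info (joint_law K) * ln 2.
Proof.
move=> K1; pose p := joint_fdist K; pose q := Defs.pushforward fst p.
have q1 : \sum_W q W = 1 by rewrite sum_pushforward1 fdist_sum1.
pose b := @Mixture R G (@independent G) (indep_sets G)
  (FDist (pushforward_ge0 fst p) q1) val
  (fun W : {S : {set G} | independent S} => valP W).
have p_supp z : p z != 0 -> z.2 \in val z.1.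
  apply: contra_neqT => zN; apply/eqP; rewrite eq_le fdist_ge0 andbT.
  rewrite -[leRHS](subrr 1) -[X in X - _](fdist_sum1 p) -[X in _ - X]K1.
  rewrite [X in X - _](bigID (fun z : (indep_sets G * G)%type => z.2 \in val z.1))/= addrAC subrr add0r.
  by rewrite (bigD1 z)//= lerDl sumr_ge0// => y _; exact: joint_law_ge0.
have Pb v : pdist G v <= mix_pt b v.
  rewrite -(joint_law_sum2 K) (bigID (fun W : indep_sets G => v \in val W))/=.
  rewrite [X in _ + X]big1 ?addr0 => [|W]; last first.
    by move=> vW; apply/eqP; apply: contraNT vW => /(p_supp (W, v)).
  apply: ler_sum => W _; exact: (le_pushforward fst p (W, v)).
have db : dominates (pdist G) (mix_pt b) by move=> v Pv; exact: lt_le_trans Pv (Pb v).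
exists b => //; rewrite (mutual_infoE p).
(* For fixed [v], the sum of [q W * t (W, v)] over [W] is at most 1, so [s] is a subprobability to
   compare with [p]. *)
pose t (z : (indep_sets G * G)%type) : R := (z.2 \in val z.1)%:R / mix_pt b z.2.
pose s (z : (indep_sets G * G)%type) := q z.1 * pdist G z.2 * t z.
have p_gt0 z : 0 < p z -> [/\ 0 < q z.1, 0 < pdist G z.2 & 0 < t z].
  move=> pz; have Pz : 0 < pdist G z.2.
    by rewrite -(joint_law_snd K); apply: lt_le_trans pz _; exact: (le_pushforward snd p).
  split=> //; first by apply: lt_le_trans pz _; exact: (le_pushforward fst p).
  by rewrite /t p_supp ?gt_eqF// mul1r invr_gt0 db.
have : xent p s <= xent p p.
  apply: gibbs => [z|z|z /p_gt0[? ? ?]|]; first exact: fdist_ge0.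
  - by rewrite /s !mulr_ge0 ?invr_ge0 ?mix_pt_ge0 ?fdist_ge0//; exact: (pushforward_ge0 fst p).
  - by apply: mulr_gt0 => //; exact: mulr_gt0.
  - rewrite fdist_sum1 (eq_bigr (fun z => s (z.1, z.2))); last by case.
    rewrite -(pair_bigA _ (fun W v => s (W, v)))/= -(fdist_sum1 (pdist G)).
    have := sum_mix_pt b (fun v => pdist G v / mix_pt b v).
    rewrite [RHS](_ : _ = \sum_W \sum_v s (W, v)).
      move=> <-; apply: ler_sum => v _.
      have [->|b0] := eqVneq (mix_pt b v) 0; first by rewrite mul0r fdist_ge0.
      by rewrite mulrCA divff// mulr1.
    apply: eq_bigr => W _ /=; rewrite big_mkcond mulr_sumr; apply: eq_bigr => v _.
    by rewrite /s /t/=; case: ifP; rewrite ?mul1r ?mul0r ?mulr0 ?mulrA.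
rewrite /s (@xent_mulr _ _ _ (fun z => q z.1 * pdist G z.2) t); first last.
- by move=> z /p_gt0[].
- by move=> z /p_gt0[? ? ?]; rewrite mulr_gt0.
- exact: fdist_ge0.
have -> : xent p t = - xent (pdist G) (mix_pt b).
  rewrite (@eq_xent _ _ _ _ (fun z => (mix_pt b z.2)^-1)); last first.
    by move=> z /p_supp zz; rewrite /t zz mul1r.
  rewrite xentV; first last.
  - by move=> z /p_gt0[_ /db].
  - exact: fdist_ge0.
  congr (- _); rewrite /xent -(sum_pushforward snd p (fun v => ln (mix_pt b v))).
  by apply: eq_bigr => v _; rewrite joint_law_snd.
have -> : xent p (fun z => q z.1 * pdist G z.2) =
    xent p (fun z => Defs.pushforward fst p z.1 * Defs.pushforward snd p z.2).
  by apply: eq_xent => z _; rewrite joint_law_snd.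
by lra.
Qed.

(** Given [v], the channel draws the random independent set conditioned on containing [v]. *)
Lemma mutual_info_le (G : pgraph R) (b : mixture R (@independent G)) :
  dominates (pdist G) (mix_pt b) ->
  exists K : G -> fdist R (indep_sets G),
  \sum_(wv : indep_sets G * G | wv.2 \in val wv.1) joint_law K wv = 1 /\
  mutual_info (joint_law K) * ln 2 <= - xent (pdist G) (mix_pt b).
Proof.
move=> db; pose f i : indep_sets G := Sub (mix_set b i) (mix_setP b i).
pose Q := Defs.pushforward f (mix_law b).
have Q0 : forall W, 0 <= Q W by exact: pushforward_ge0.
have Q1 : \sum_W Q W = 1 by rewrite sum_pushforward1 fdist_sum1.
have Qb v : \sum_W Q W * (v \in val W)%:R = mix_pt b v.
  rewrite sum_pushforward /mix_pt [RHS]big_mkcond; apply: eq_bigr => i _ /=.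
  by case: ifP; rewrite ?mulr1 ?mulr0.
(* Off the support of [P] the conditioning event may be null, so the unconditioned law is used. *)
pose k (v : G) (W : indep_sets G) := if 0 < pdist G v then Q W * (v \in val W)%:R / mix_pt b v else Q W.
have k0 v W : 0 <= k v W.
  by rewrite /k; case: ifP => // _; rewrite !mulr_ge0 ?invr_ge0 ?mix_pt_ge0.
have k1 v : \sum_W k v W = 1.
  rewrite /k; have [Pv|//] := boolP (0 < pdist G v).
  by rewrite -mulr_suml Qb divff// gt_eqF//; exact: db.
pose K v := FDist (k0 v) (k1 v).
pose p := joint_fdist K; pose q := Defs.pushforward fst p.
have P_gt0 z : p z != 0 -> 0 < pdist G z.2.
  move=> pz; rewrite lt_def fdist_ge0 andbT.
  by apply: contraNneq pz => P0; rewrite /= /joint_law P0 mul0r.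
have pE z : p z != 0 -> p z = Q z.1 * pdist G z.2 * (mix_pt b z.2)^-1.
  move=> pz; have Pz := P_gt0 _ pz; move: pz; rewrite /= /joint_law /= /k Pz.
  case: (z.2 \in val z.1); last by rewrite mulr0 !(mul0r, mulr0) eqxx.
  by rewrite mulr1 => _; ring.
have p_supp (z : (indep_sets G * G)%type) : z.2 \notin val z.1 -> p z = 0.
  move=> zN; rewrite /= /joint_law /= /k; case: ifP => Pz.
    by rewrite (negPf zN) !(mul0r, mulr0).
  suff -> : pdist G z.2 = 0 by rewrite mul0r.
  by apply/eqP; rewrite eq_le fdist_ge0 andbT leNgt Pz.
have q_gt0 W : 0 < q W -> 0 < Q W.
  move=> qW; rewrite lt_def Q0 andbT; apply: contraTneq qW => QW.
  rewrite -leNgt /q /Defs.pushforward big1// => z /eqP zW.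
  apply/eqP; apply: contraT => pz; move: (pz).
  by rewrite (pE _ pz) zW QW !mul0r eqxx.
have p_gt0 z : 0 < p z -> [/\ 0 < q z.1, 0 < Q z.1 & 0 < pdist G z.2].
  move=> pz; have qz : 0 < q z.1.
    by apply: lt_le_trans pz _; exact: (le_pushforward fst p).
  by split=> //; [exact: q_gt0|rewrite P_gt0 ?gt_eqF].
exists K; split.
  rewrite -(fdist_sum1 p) [RHS](bigID (fun z : (indep_sets G * G)%type => z.2 \in val z.1))/=.
  by rewrite [X in _ = _ + X]big1 ?addr0// => z /p_supp.
have p0 z : 0 <= p z by exact: fdist_ge0.
have pp : xent p p = xent p (fun z => Q z.1) + xent p (fun z => pdist G z.2) -
    xent p (fun z => mix_pt b z.2).
  rewrite [LHS](eq_xent pE) xent_mulr//; first last.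
  - by move=> z /p_gt0[_ _ /db]; rewrite invr_gt0.
  - by move=> z /p_gt0[? ? ?]; rewrite mulr_gt0.
  by rewrite xentV// ?xent_mulr// => z /p_gt0[] // _ _ /db.
have pq : xent p (fun z => Defs.pushforward fst p z.1 * Defs.pushforward snd p z.2) =
    xent p (fun z => q z.1) + xent p (fun z => pdist G z.2).
  rewrite -xent_mulr//; try by move=> z /p_gt0[].
  by apply: eq_xent => z _; rewrite joint_law_snd.
rewrite (mutual_infoE p) pp pq.
have -> : xent p (fun z => mix_pt b z.2) = xent (pdist G) (mix_pt b).
  rewrite /xent -(sum_pushforward snd p (fun v => ln (mix_pt b v))).
  by apply: eq_bigr => v _; rewrite joint_law_snd.
have -> : xent p (fun z => Q z.1) = xent q Q.
  by rewrite /xent -(sum_pushforward fst p (fun W => ln (Q W))).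
have -> : xent p (fun z => q z.1) = xent q q.
  by rewrite /xent -(sum_pushforward fst p (fun W => ln (q W))).
(* The marginal [q] of the channel may differ from [Q]; Gibbs' inequality gives the difference the
   right sign. *)
have : xent q Q <= xent q q.
  apply: gibbs => //; first exact: pushforward_ge0.
  by rewrite Q1 sum_pushforward1 fdist_sum1.
by lra.
Qed.

(** Every admissible channel yields a mixture subject to weak duality; [b] shows that some channel
    is admissible, so the infimum is a genuine one. *)
Lemma korner_entropy_ge (G : pgraph R) (a : mixture R (@is_clique G))
    (b : mixture R (@independent G)) :
  dominates (pdist G) (mix_pt a) -> dominates (pdist G) (mix_pt b) ->
  xent (pdist G) (mix_pt a) - xent (pdist G) (pdist G) <= korner_entropy G * ln 2.
Proof.
move=> da db; rewrite -ler_pdivrMr ?ln2_gt0//; apply: lb_le_inf.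
  by have [K [K1 _]] := mutual_info_le db; exists (mutual_info (joint_law K)), K.
move=> _ [K [K1 ->]]; rewrite ler_pdivrMr ?ln2_gt0//.
by have [b' db'] := mutual_info_ge K1; apply: le_trans; exact: weak_duality_xent.
Qed.

Lemma korner_entropy_le (G : pgraph R) (b : mixture R (@independent G)) :
  dominates (pdist G) (mix_pt b) ->
  korner_entropy G * ln 2 <= - xent (pdist G) (mix_pt b).
Proof.
move=> db; have [K [K1 le_I]] := mutual_info_le db.
apply: le_trans le_I; rewrite ler_pM2r ?ln2_gt0//; apply: ge_inf; last by exists K.
exists 0 => _ [K' [K'1 ->]].
have [b' db' b'I] := mutual_info_ge K'1.
rewrite -(pmulr_lge0 _ (ln2_gt0 R)); apply: le_trans b'I.
have da : dominates (pdist G) (mix_pt (point_mixture G)).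
  by move=> v; rewrite point_mixtureE.
apply: le_trans (weak_duality_xent da db').
by rewrite (@eq_xent _ _ _ _ (pdist G)) ?subrr// => v _; exact: point_mixtureE.
Qed.

Lemma sandwiched_korner (G : pgraph R) x : sandwiched G x ->
  korner_entropy G = x / ln 2.
Proof.
move=> GS; apply: (mulIf (lt0r_neq0 (ln2_gt0 R))); rewrite divfK ?gt_eqF ?ln2_gt0//.
apply/eqP; rewrite eq_le; apply/andP; split.
  apply/ler_addgt0Pr => e /GS[a [b [da db _ xb]]].
  by apply: le_trans xb; exact: korner_entropy_le.
apply/ler_addgt0Pr => e /GS[a [b [da db xa _]]]; rewrite -lerBlDr.
by apply: le_trans xa _; exact: korner_entropy_ge db.
Qed.

End Entropies.

(** * Perfect graphs *)

Section Perfect.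
Variable R : realType.

Section Uniform.
Variable n : nat.

Lemma uniform_ge0 (i : 'I_n.+1) : 0 <= (n.+1%:R : R)^-1.
Proof. by rewrite invr_ge0. Qed.

Lemma uniform_sum1 : \sum_(i < n.+1) (n.+1%:R : R)^-1 = 1.
Proof. by rewrite sumr_const card_ord -[LHS]mulr_natr mulVf// pnatr_eq0. Qed.

Definition uniform : fdist R 'I_n.+1 := FDist uniform_ge0 uniform_sum1.
End Uniform.

(** Rounding [(n + 1) * b] down gives integer weights of at most [n + 1] on cliques; a uniform
    choice among the [n + 1] sets of the cover loses only the rounding error. *)
Lemma perfect_approx (G : sgraph) (b : G -> R) n : perfect G ->
  (forall v, 0 <= b v) ->
  (forall K : {set G}, is_clique K -> \sum_(v in K) b v <= 1) ->
  exists m : mixture R (@independent G), forall v, b v - n.+1%:R^-1 <= mix_pt m v.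
Proof.
move=> pG b0 bK; pose w v := Num.trunc (n.+1%:R * b v).
have wb v : (w v)%:R <= n.+1%:R * b v < (w v).+1%:R.
  by rewrite truncn_itv// mulr_ge0.
have [|s [sz sI sw]] := @weighted_coloring G w n.+1 pG.
  move=> K /bK bK1; rewrite -(ler_nat R) natr_sum.
  apply: (@le_trans _ _ (n.+1%:R * \sum_(v in K) b v)).
    by rewrite mulr_sumr; apply: ler_sum => v _; case/andP: (wb v).
  by rewrite ler_piMr.
have sP (i : 'I_n.+1) : independent (nth finset.set0 s i).
  by apply: (allP sI); rewrite mem_nth// sz.
exists (@Mixture R G (@independent G) _ (uniform n) _ sP) => v.
have -> : mix_pt (Mixture (uniform n) sP) v = (w v)%:R / n.+1%:R.
  rewrite /mix_pt/= sumr_const -[LHS]mulr_natl; congr (_%:R * _).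
  rewrite -sw -sum1_count (big_nth finset.set0) sz big_mkord -sum1_card.
  by apply: eq_bigl.
rewrite ler_pdivlMr// mulrBl mulVf ?pnatr_eq0// lerBlDr mulrC.
by have /andP[_ /ltW] := wb v; rewrite natr1.
Qed.

Lemma big_option (T : finType) (F : option T -> R) :
  \sum_i F i = F None + \sum_i F (Some i).
Proof.
rewrite (bigD1 None)//=; congr (_ + _).
rewrite (reindex_omap Some id) => [|[]//]; apply: eq_bigl => i.
by rewrite eqxx.
Qed.

Section Perturbation.
Variables (G : sgraph) (a : mixture R (@is_clique G)) (K : {set G}).
Variables (cK : is_clique K) (t : R) (t01 : 0 <= t <= 1).

(** A point of the segment from [a] to [K]: the index [None] stands for [K]. *)
Definition perturbed_law (i : option (mix_index a)) : R :=
  if i is Some j then (1 - t) * mix_law a j else t.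

Lemma perturbed_law_ge0 i : 0 <= perturbed_law i.
Proof.
have /andP[t0 t1] := t01.
by case: i => [j|]//=; rewrite mulr_ge0 ?fdist_ge0// subr_ge0.
Qed.

Lemma perturbed_law_sum1 : \sum_i perturbed_law i = 1.
Proof. by rewrite big_option/= -mulr_sumr fdist_sum1 mulr1 subrKC. Qed.

Definition perturbed_set (i : option (mix_index a)) : {set G} :=
  if i is Some j then mix_set a j else K.

Lemma perturbed_setP i : is_clique (perturbed_set i).
Proof. by case: i => [j|]//=; exact: mix_setP. Qed.

Definition perturbed : mixture R (@is_clique G) :=
  @Mixture R G (@is_clique G) _ (FDist perturbed_law_ge0 perturbed_law_sum1)
    perturbed_set perturbed_setP.

Lemma perturbedE v :
  mix_pt perturbed v = (1 - t) * mix_pt a v + t * (v \in K)%:R.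
Proof.
rewrite {1}/mix_pt/= big_mkcond big_option/= addrC; congr (_ + _).
  by rewrite /mix_pt mulr_sumr [RHS]big_mkcond.
by case: ifP; rewrite ?mulr1 ?mulr0.
Qed.
End Perturbation.

Section Optimum.
Variable G : pgraph R.
Let P := pdist G.

Definition clique_values : set R := [set x | exists a : mixture R (@is_clique G),
  dominates P (mix_pt a) /\ x = xent P (mix_pt a)]%classic.

Let M := sup clique_values.

Lemma xent_mix_le0 (Q : pred {set G}) (a : mixture R Q) : xent P (mix_pt a) <= 0.
Proof.
rewrite -oppr_ge0 /xent -sumrN; apply: sumr_ge0 => v _.
by rewrite -mulrN mulr_ge0 ?fdist_ge0// oppr_ge0 ln_le0// mix_pt_le1.
Qed.

Lemma has_sup_clique_values : has_sup clique_values.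
Proof.
split; last by exists 0 => _ [a [_ ->]]; exact: xent_mix_le0.
exists (xent P (mix_pt (point_mixture G))), (point_mixture G); split=> // v.
by rewrite point_mixtureE.
Qed.

Lemma le_sup_clique (a : mixture R (@is_clique G)) : dominates P (mix_pt a) ->
  xent P (mix_pt a) <= M.
Proof.
by move=> da; apply: sup_upper_bound; [exact: has_sup_clique_values|exists a].
Qed.

Lemma sup_clique_le0 : M <= 0.
Proof.
apply: ge_sup; first by case: has_sup_clique_values.
by move=> _ [a [_ ->]]; exact: xent_mix_le0.
Qed.

(** The sum dominates each [(P v)^-1], which gives one constant for all vertices and all
    near-maximizers. *)
Let delta := expR ((M - 1) * \sum_v (P v)^-1).

(** All terms of [xent] are at most 0, so each is at least the total. Uniformity in [a] allows a
    step size [t] fixed before [a]. *)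
Lemma near_optimum_ge (a : mixture R (@is_clique G)) : dominates P (mix_pt a) ->
  M - 1 <= xent P (mix_pt a) -> forall v, 0 < P v -> delta <= mix_pt a v.
Proof.
move=> da Ma v Pv; rewrite -[leRHS]lnK ?posrE ?da// ler_expR.
have h : M - 1 <= P v * ln (mix_pt a v).
  apply: le_trans Ma _; rewrite /xent (bigD1 v)//= gerDl -oppr_ge0 -sumrN.
  apply: sumr_ge0 => u _.
  by rewrite -mulrN mulr_ge0 ?fdist_ge0// oppr_ge0 ln_le0// mix_pt_le1.
apply: (@le_trans _ _ ((M - 1) * (P v)^-1)).
  rewrite ler_wnM2l ?subr_le0 ?(le_trans sup_clique_le0)//.
  rewrite (bigD1 v)//= lerDl sumr_ge0// => u _.
  by rewrite invr_ge0 fdist_ge0.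
by rewrite ler_pdivrMr// mulrC.
Qed.

(* The first-order optimality condition at a near-maximizer [a], along the
   segment from [a] to the clique [K]. *)
Lemma near_optimum_clique (a : mixture R (@is_clique G)) (t : R) (K : {set G}) :
  0 < t < 1 -> dominates P (mix_pt a) -> M - t ^+ 2 <= xent P (mix_pt a) ->
  is_clique K ->
  \sum_(v in K) P v / mix_pt a v <= (1 + t / delta) * (t + (1 - t)^-1).
Proof.
move=> /andP[t0 t1] da Ma cK; have t01 : 0 <= t <= 1 by rewrite !ltW.
have s0 : 0 < 1 - t by rewrite subr_gt0.
pose a' := perturbed a cK t01.
have d0 : 0 < delta by exact: expR_gt0.
have a_ge v : 0 < P v -> delta <= mix_pt a v.
  apply: near_optimum_ge => //; apply: le_trans Ma; rewrite lerD2l lerN2.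
  by rewrite expr_le1 ?ltW.
have a'E v : mix_pt a' v = (1 - t) * mix_pt a v + t * (v \in K)%:R by exact: perturbedE.
have a'a v : (1 - t) * mix_pt a v <= mix_pt a' v by rewrite a'E lerDl mulr_ge0// ltW.
have da' : dominates P (mix_pt a').
  by move=> v /da av; apply: lt_le_trans (a'a v); rewrite mulr_gt0.
(* The gain in passing from [a] to [a'] is bounded below through [1 - 1 / x <= ln x], and [a']
   cannot exceed [M]. *)
have gain : xent P (mix_pt a) + \sum_v P v * (1 - mix_pt a v / mix_pt a' v) <= M.
  apply: le_trans (le_sup_clique da'); rewrite /xent -big_split /=.
  apply: ler_sum => v _; rewrite -mulrDr.
  have [/eqP ->|Pv] := boolP (P v == 0); first by rewrite !mul0r.
  have {}Pv : 0 < P v by rewrite lt_def Pv fdist_ge0.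
  rewrite ler_pM2l// -lerBrDl -ln_div ?posrE ?da ?da'//.
  by rewrite -[X in 1 - X]invf_div ln_ge_1BV// divr_gt0 ?da ?da'.
(* The slack [t ^+ 2] divided by the step [t] leaves [t]; the other term comes from
   [mix_pt a v / mix_pt a' v <= (1 - t)^-1]. *)
have sumK : \sum_(v in K) P v / mix_pt a' v <= t + (1 - t)^-1.
  rewrite -(ler_pM2l t0).
  have e : t * (\sum_(v in K) P v / mix_pt a' v) =
      \sum_v P v * (1 - mix_pt a v / mix_pt a' v) + t * \sum_v P v * (mix_pt a v / mix_pt a' v).
    rewrite [in LHS]big_mkcond !mulr_sumr -big_split; apply: eq_bigr => v _ /=.
    have [/eqP ->|Pv] := boolP (P v == 0); first by case: ifP; rewrite !(mul0r, mulr0) addr0.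
    have {}Pv : 0 < P v by rewrite lt_def Pv fdist_ge0.
    have y0 : mix_pt a' v != 0 by rewrite gt_eqF// da'.
    have -> : P v * (1 - mix_pt a v / mix_pt a' v) + t * (P v * (mix_pt a v / mix_pt a' v)) =
        P v * (mix_pt a' v - (1 - t) * mix_pt a v) / mix_pt a' v by field.
    have -> : mix_pt a' v - (1 - t) * mix_pt a v = t * (v \in K)%:R.
      by rewrite a'E addrAC subrr add0r.
    case: (v \in K); last by rewrite !(mul0r, mulr0).
    by rewrite mulr1 mulrCA mulrA.
  have h : \sum_v P v * (mix_pt a v / mix_pt a' v) <= (1 - t)^-1.
    rewrite -[leRHS]mul1r -[X in _ <= X * _](fdist_sum1 P) mulr_suml; apply: ler_sum => v _.
    have [/eqP ->|Pv] := boolP (P v == 0); first by rewrite !mul0r.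
    have {}Pv : 0 < P v by rewrite lt_def Pv fdist_ge0.
    by rewrite ler_pM2l// ler_pdivrMr ?da'// mulrC ler_pdivlMr// mulrC.
  rewrite e mulrDr lerD ?ler_pM2l//.
  by move: gain Ma; rewrite expr2; lra.
(* Back from [a'] to [a]: on [K], [a'] exceeds [a] by at most [t], which is at most [t / delta]
   times [a]. *)
apply: (@le_trans _ _ ((1 + t / delta) * \sum_(v in K) P v / mix_pt a' v)); last first.
  by rewrite ler_wpM2l// addr_ge0// divr_ge0// ltW.
rewrite mulr_sumr; apply: ler_sum => v vK.
have [/eqP ->|Pv] := boolP (P v == 0); first by rewrite !mul0r mulr0.
have {}Pv : 0 < P v by rewrite lt_def Pv fdist_ge0.
rewrite mulrCA ler_pM2l// ler_pdivlMr ?da'// mulrC ler_pdivrMr ?da//.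
rewrite a'E vK mulr1 [leRHS]mulrDl [X in _ <= X + _]mul1r lerD//.
  by rewrite ler_piMl ?mix_pt_ge0// gerBl ltW.
by rewrite -mulrA ler_peMr ?(ltW t0)// mulrC ler_pdivlMr// mul1r a_ge.
Qed.

Lemma perfect_sandwiched : perfect G -> sandwiched G (M - xent P P).
Proof.
move=> pG e e0.
have d0 : 0 < delta by exact: expR_gt0.
(* [ln C] costs at most [t / delta + 3 * t], and the rounding factor [1 - t] costs [2 * t]; both use
   [t <= 1 / 2]. *)
pose D := delta^-1 + 5; have D0 : 0 < D by rewrite addr_gt0 ?invr_gt0.
pose t := Num.min 2^-1 (e / D).
have t0 : 0 < t by rewrite lt_min invr_gt0 ltr0n divr_gt0.
have t2 : t <= 2^-1 by rewrite ge_min lexx.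
have tD : t * D <= e by rewrite -ler_pdivlMr// ge_min lexx orbT.
have t1 : t < 1 by apply: le_lt_trans t2 _; rewrite invf_lt1// ltr1n.
have te : t <= e.
  apply: le_trans tD; rewrite ler_peMr ?(ltW t0)// ler_wpDl ?invr_ge0 ?(ltW d0)//.
  by rewrite ler1n.
have s0 : 0 < 1 - t by rewrite subr_gt0.
have tt0 : 0 < t ^+ 2 by rewrite exprn_gt0.
have tt : t ^+ 2 <= t by rewrite expr2 ler_piMl ?ltW.
have [_ [a [da ->]] Ma] := sup_adherent tt0 has_sup_clique_values.
set C := (1 + t / delta) * (t + (1 - t)^-1).
have u0 : 0 < 1 + t / delta by rewrite addr_gt0// divr_gt0.
have u1 : 0 < t + (1 - t)^-1 by rewrite addr_gt0// invr_gt0.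
have C0 : 0 < C by rewrite mulr_gt0.
pose b v := P v / (mix_pt a v * C).
have b_ge0 v : 0 <= b v by rewrite divr_ge0 ?fdist_ge0// mulr_ge0 ?mix_pt_ge0 ?ltW.
have bK (K : {set G}) : is_clique K -> \sum_(v in K) b v <= 1.
  move=> cK; rewrite (eq_bigr (fun v => P v / mix_pt a v / C)).
    rewrite -mulr_suml ler_pdivrMr// mul1r.
    by apply: near_optimum_clique => //; rewrite ?t0// ltW.
  by move=> v _; rewrite /b invfM mulrA.
have db : dominates P b by move=> v Pv; rewrite divr_gt0// mulr_gt0// da.
(* With more than [L] sets the rounding error is at most [t * b v] on the support, a relative loss
   of [t]. *)
pose L := \sum_v (t * b v)^-1.
have [m bm] := perfect_approx (Num.trunc L) pG b_ge0 bK.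
have b_lo v : 0 < P v -> (1 - t) * b v <= mix_pt m v.
  move=> Pv; apply: le_trans (bm v); rewrite mulrBl mul1r lerD2l lerN2.
  have tb : 0 < t * b v by rewrite mulr_gt0 ?db.
  rewrite invf_ple ?posrE//.
  have L0 : 0 <= L by apply: sumr_ge0 => u _; rewrite invr_ge0 mulr_ge0// ltW.
  apply: le_trans (ltW (proj2 (andP (truncn_itv L0)))).
  rewrite /L (bigD1 v)//= lerDl sumr_ge0// => u _.
  by rewrite invr_ge0 mulr_ge0// ltW.
have dm : dominates P (mix_pt m).
  by move=> v Pv; apply: lt_le_trans (b_lo v Pv); rewrite mulr_gt0 ?db.
exists a, m; split=> //.
  by move: Ma tt te; rewrite -/M -/P; lra.
have xm : xent P (fun v => (1 - t) * b v) <= xent P (mix_pt m).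
  apply: le_xent => [v|v Pv|//]; first exact: fdist_ge0.
  by rewrite mulr_gt0 ?db.
rewrite xent_mulr ?xent_cst// in xm; last exact: fdist_ge0.
have xb : xent P b = xent P P - xent P (mix_pt a) - ln C.
  rewrite /b xent_mulr//; first last.
  - by move=> v Pv; rewrite invr_gt0 mulr_gt0 ?da.
  - exact: fdist_ge0.
  rewrite xentV; first last.
  - by move=> v Pv; rewrite mulr_gt0 ?da.
  - exact: fdist_ge0.
  rewrite xent_mulr//; last exact: fdist_ge0.
  by rewrite xent_cst; lra.
have aM := le_sup_clique da.
have lnC : ln C = ln (1 + t / delta) + ln (t + (1 - t)^-1) by rewrite lnM.
have l1 : ln (1 + t / delta) <= t * delta^-1.
  by apply: le_ln1Dx; apply: lt_trans (_ : 0 < _); rewrite ?ltrN10 ?divr_gt0.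
have l2 : - (2 * t) <= ln (1 - t).
  apply: le_trans (ln_ge_1BV s0).
  have -> : 1 - (1 - t)^-1 = - (t / (1 - t)) by field; rewrite gt_eqF.
  rewrite lerN2 ler_pdivrMr//.
  have : 0 <= t * (1 - 2 * t) by rewrite mulr_ge0 ?(ltW t0)// subr_ge0; lra.
  by lra.
have l3 : ln (t + (1 - t)^-1) <= t - ln (1 - t).
  have -> : t + (1 - t)^-1 = (1 + t * (1 - t)) / (1 - t) by field; rewrite gt_eqF.
  have tt' : 0 < t * (1 - t) by rewrite mulr_gt0.
  have n0 : 0 < 1 + t * (1 - t) by rewrite addr_gt0.
  rewrite ln_div ?posrE// lerD2r.
  apply: le_trans (le_ln1Dx _) _; first by apply: lt_trans tt'; rewrite ltrN10.
  by rewrite ler_piMr ?ltW// gtrBl.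
have tD' : t * delta^-1 + t * 5 <= e by rewrite -mulrDr.
by move: xm xb aM lnC l1 l2 l3 tD'; rewrite -/P; lra.
Qed.

End Optimum.
End Perfect.

Theorem mainTheorem3 (R : realType) (A : finType) (PA : fdist R A)
    (G : A -> pgraph R) (HG : forall a : A, perfect (G a)) :
  (compl_graph_entropy (and_prod G) = \sum_(a : A) compl_graph_entropy (G a) /\
   \sum_(a : A) compl_graph_entropy (G a) = \sum_(a : A) korner_entropy (G a)) /\
  (compl_graph_entropy (disjoint_union PA G) =
     \sum_(a : A) PA a * compl_graph_entropy (G a) /\
   \sum_(a : A) PA a * compl_graph_entropy (G a) =
     \sum_(a : A) PA a * korner_entropy (G a)).
Proof.
pose x a := sup (clique_values (G a)) - xent (pdist (G a)) (pdist (G a)).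
have Gx a : sandwiched (G a) (x a) by exact: perfect_sandwiched (HG a).
have GH a : compl_graph_entropy (G a) = x a / ln 2 by exact: sandwiched_compl_entropy.
have GK a : korner_entropy (G a) = x a / ln 2 by exact: sandwiched_korner.
rewrite (sandwiched_compl_entropy (sandwiched_and Gx)).
rewrite (sandwiched_compl_entropy (sandwiched_union PA Gx)) !mulr_suml.
by repeat split; apply: eq_bigr => a _; rewrite ?GH ?GK// mulrA.
Qed.
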